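(* Let $k$ be a field and let $f:\mathbb{N}\rightarrow\mathbb{N}$ be a monotonely increasing function ($f(n)<f(n+1)$ for all $n$) which is submultiplicative ($f(n+m)\leq f(n)f(m)$ for all $n,m$), such that: (1) there exists a positive integer $\alpha$ for which $nf(n)\leq f(\alpha n)$ for all $n\in\mathbb{N}$; (2) for every real $\beta>0$ there is some $n_\beta\in\mathbb{N}$ such that for all $n\geq n_\beta$ we have $f(2^{n+1})\leq \frac{1}{\beta}f(2^n)^2$; (3) $\prod_{n=0}^{\infty}\left(1+\frac{f(2^n)}{f(2^{n+1})}\right)<\infty$. Then there exists a finitely generated monomial $k$-algebra which is just-infinite and primitive and whose growth type is $\sim f$. Moreover, this algebra can be taken to be a Bartholdi–Smoktunowicz algebra associated with $f$ (as defined in the context).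
   Context: Here $\mathbb{N}=\{1,2,3,\dots\}$ for arguments and values of $f$; algebras are associative over the field $k$. Growth: for a finitely generated algebra $R$ with a finite-dimensional generating subspace $V\ni 1$, the growth function is $n\mapsto \dim_k V^n$. For monotonely increasing $f,g$ write $f\sim g$ if there exist positive integers $C,D$ with $f(n)\leq g(Cn)\leq f(Dn)$ for all $n$. The growth function of $R$ is well defined up to $\sim$, and ''$R$ has growth type $\sim f$'' means its growth function is $\sim f$. A monomial algebra is a quotient of a free algebra $k\langle x_1,\dots,x_d\rangle$ by an ideal generated by monomials. An algebra is just-infinite if it is infinite-dimensional and all of its quotients by nonzero two-sided ideals are finite-dimensional. Bartholdi–Smoktunowicz algebras associated with $f$: put $d=f(1)$ and take letters $x_1,\dots,x_d$. Let $W(1)=\{x_1,\dots,x_d\}$. For every integer $i\geq 0$, given the set $W(2^i)$ of monomials of length $2^i$, choose a subset $C(2^i)\subseteq W(2^i)$ of cardinality $\lceil f(2^{i+1})/f(2^i)\rceil$, and set $W(2^{i+1})=C(2^i)W(2^i)=\{uv: u\in C(2^i), v\in W(2^i)\}$. Let $W=\bigcup_{i\geq 0}W(2^i)$, let $I\triangleleft k\langle x_1,\dots,x_d\rangle$ be the ideal generated by all monomials which do not occur as (contiguous) subwords of any monomial from $W$, and set $R=k\langle x_1,\dots,x_d\rangle/I$. Any algebra $R$ obtained in this way, for some choice of the sets $C(2^i)$, is called a Bartholdi–Smoktunowicz algebra associated with $f$. *)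

(* Defs.v *)
From HB Require Import structures.
From mathcomp Require Import all_boot all_order all_algebra.
From mathcomp Require Import finmap.
From mathcomp Require Import boolp classical_sets.
From mathcomp Require Import monalg.

Set Implicit Arguments.
Unset Strict Implicit.
Unset Printing Implicit Defensive.

Import Order.TTheory GRing.Theory Num.Theory.
Import Quotient.

Local Open Scope classical_set_scope.
Local Open Scope quotient_scope.
Local Open Scope ring_scope.

(* MathComp's [idealr] is a proper left ideal; its quotient rings are only
   available over commutative rings, so two-sided ideals and the corresponding
   quotient algebras are added here.  Ideals are boolean predicates; with the
   classical axioms of [boolp] every set is of this form.  *)
HB.mixin Record isMulrClosedIdeal (A : nzRingType) (S : A -> bool) := {
  ideal_mulr_subproof : forall a, {in S, forall u, u * a \in S}
}.

#[short(type="tsideal")]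
HB.structure Definition TsIdeal (A : nzRingType) :=
  {S of Idealr A S & isMulrClosedIdeal A S}.

Section QuotientAlgebra.
Variables (k : fieldType) (A : algType k) (I : tsideal A).

Definition alg_quot : Type := {quot I}.

HB.instance Definition _ := GRing.Zmodule.on alg_quot.
HB.instance Definition _ := EqQuotient.on alg_quot.

Definition alg_pi (x : A) : alg_quot := \pi_({quot I}) x.

Lemma alg_piP (x y : A) : (alg_pi x == alg_pi y) = (x - y \in I).
Proof. by rewrite /alg_pi piE. Qed.

Lemma alg_pi_surj (q : alg_quot) : exists x, alg_pi x = q.
Proof. by exists (repr (q : {quot I})); rewrite /alg_pi reprK. Qed.

Lemma alg_pi_zmod : zmod_morphism alg_pi.
Proof. by move=> x y; rewrite /alg_pi !piE. Qed.

Lemma alg_pi_mulr (a x y : A) :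
  alg_pi x = alg_pi y -> alg_pi (x * a) = alg_pi (y * a).
Proof.
move=> /eqP; rewrite alg_piP => h; apply/eqP; rewrite alg_piP -mulrBl.
exact: ideal_mulr_subproof.
Qed.

Lemma alg_pi_mull (a x y : A) :
  alg_pi x = alg_pi y -> alg_pi (a * x) = alg_pi (a * y).
Proof.
move=> /eqP; rewrite alg_piP => h; apply/eqP; rewrite alg_piP -mulrBr.
exact: idealMr.
Qed.

Definition alg_rep (q : alg_quot) : A := repr (q : {quot I}).

Lemma alg_repK q : alg_pi (alg_rep q) = q.
Proof. exact: reprK. Qed.

Definition qone : alg_quot := alg_pi 1.
Definition qmul (p q : alg_quot) : alg_quot := alg_pi (alg_rep p * alg_rep q).
Definition qscale (c : k) (q : alg_quot) : alg_quot := alg_pi (c *: alg_rep q).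

Lemma qmulE x y : qmul (alg_pi x) (alg_pi y) = alg_pi (x * y).
Proof.
rewrite /qmul (alg_pi_mulr _ (alg_repK (alg_pi x))).
exact: alg_pi_mull (alg_repK _).
Qed.

Lemma qscaleE c x : qscale c (alg_pi x) = alg_pi (c *: x).
Proof.
rewrite /qscale -[c *: alg_rep _]mulr_algl -[c *: x]mulr_algl.
exact: alg_pi_mull (alg_repK _).
Qed.

Let piD x y : alg_pi (x + y) = alg_pi x + alg_pi y.
Proof. by rewrite /alg_pi !piE. Qed.

Let lift1 (P : alg_quot -> Prop) : (forall x, P (alg_pi x)) -> forall q, P q.
Proof. by move=> h q; rewrite -[q]alg_repK. Qed.

Let qmulA : associative qmul.
Proof.
elim/lift1=> x; elim/lift1=> y; elim/lift1=> z.
by rewrite !qmulE mulrA.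
Qed.

Let qmul1 : left_id qone qmul.
Proof. by elim/lift1=> x; rewrite qmulE mul1r. Qed.

Let qmulr1 : right_id qone qmul.
Proof. by elim/lift1=> x; rewrite qmulE mulr1. Qed.

Let qmulDl : left_distributive qmul +%R.
Proof.
elim/lift1=> x; elim/lift1=> y; elim/lift1=> z.
by rewrite -piD !qmulE mulrDl piD.
Qed.

Let qmulDr : right_distributive qmul +%R.
Proof.
elim/lift1=> x; elim/lift1=> y; elim/lift1=> z.
by rewrite -piD !qmulE mulrDr piD.
Qed.

Let qone_neq0 : qone != 0.
Proof.
have -> : (0 : alg_quot) = alg_pi 0 by rewrite /alg_pi piE.
by rewrite /qone alg_piP subr0 idealr1.
Qed.

HB.instance Definition _ := GRing.Zmodule_isNzRing.Build alg_quot
  qmulA qmul1 qmulr1 qmulDl qmulDr qone_neq0.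

Let qscaleA a b v : qscale a (qscale b v) = qscale (a * b) v.
Proof. by elim/lift1: v => x; rewrite !qscaleE scalerA. Qed.

Let qscale1 : left_id 1 qscale.
Proof. by elim/lift1=> x; rewrite qscaleE scale1r. Qed.

Let qscaleDr : right_distributive qscale +%R.
Proof.
by move=> c; elim/lift1=> x; elim/lift1=> y; rewrite -piD !qscaleE scalerDr piD.
Qed.

Let qscaleDl v : {morph qscale^~ v : a b / a + b}.
Proof. by move=> a b; elim/lift1: v => x; rewrite !qscaleE scalerDl piD. Qed.

HB.instance Definition _ := GRing.Zmodule_isLmodule.Build k alg_quot
  qscaleA qscale1 qscaleDr qscaleDl.

Let qscaleAl (c : k) (p q : alg_quot) : c *: (p * q) = (c *: p) * q.
Proof.
elim/lift1: p => x; elim/lift1: q => y; rewrite /GRing.scale /GRing.mul /=.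
by rewrite qmulE !qscaleE qmulE scalerAl.
Qed.

HB.instance Definition _ := GRing.Lmodule_isLalgebra.Build k alg_quot qscaleAl.

Let qscaleAr (c : k) (p q : alg_quot) : c *: (p * q) = p * (c *: q).
Proof.
elim/lift1: p => x; elim/lift1: q => y; rewrite /GRing.scale /GRing.mul /=.
by rewrite qmulE !qscaleE qmulE scalerAr.
Qed.

HB.instance Definition _ := GRing.Lalgebra_isAlgebra.Build k alg_quot qscaleAr.

HB.instance Definition _ :=
  GRing.isZmodMorphism.Build A alg_quot alg_pi alg_pi_zmod.
HB.instance Definition _ := GRing.isMonoidMorphism.Build A alg_quot alg_pi
  (conj (erefl : alg_pi 1 = 1) (fun x y => esym (qmulE x y))).
HB.instance Definition _ := GRing.isScalable.Build k A alg_quot *:%R alg_pi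
  (fun c x => esym (qscaleE c x)).

End QuotientAlgebra.

Definition two_sided (A : nzRingType) (S : set A) : Prop :=
  [/\ S 0, forall x y, S x -> S y -> S (x - y)
    & forall a x, S x -> S (a * x) /\ S (x * a)].

Definition ideal_gen (A : nzRingType) (G : set A) : set A :=
  smallest (@two_sided A) G.

Definition alg_iso (k : fieldType) (A B : algType k) : Prop :=
  exists phi : {lrmorphism A -> B}, bijective phi.

Definition submodule (R : pzRingType) (M : lmodType R) (N : set M) : Prop :=
  N 0 /\ forall a x y, N x -> N y -> N (a *: x + y).

Section Dimension.
Variables (k : fieldType) (V : lmodType k).

Definition lspan (s : seq V) : set V :=
  [set x | exists c : 'I_(size s) -> k, x = \sum_i c i *: s`_i].

Definition lin_indep (s : seq V) : Prop :=
  forall c : 'I_(size s) -> k, \sum_i c i *: s`_i = 0 -> forall i, c i = 0.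

Definition has_dim (U : set V) (n : nat) : Prop :=
  exists s : seq V, [/\ size s = n, lin_indep s & lspan s = U].

Definition fin_dim : Prop := exists n, has_dim setT n.

End Dimension.

Arguments fin_dim {k} V.

Section Algebras.
Variables (k : fieldType) (A : algType k).

Definition subalgebra (S : set A) : Prop :=
  [/\ submodule S, S 1 & forall x y, S x -> S y -> S (x * y)].

Definition generates (X : set A) : Prop := smallest subalgebra X = setT.

Definition fin_generated : Prop := exists s : seq A, generates [set` s].

Definition power_space (V : set A) (n : nat) : set A :=
  smallest (@submodule k A)
    [set x | exists v : 'I_n -> A, (forall i, V (v i)) /\ x = \prod_i v i].

(* The quotient by the improper ideal is 0, so only proper ideals matter.  *)
Definition just_infinite : Prop :=
  ~ fin_dim A /\
  forall J : tsideal A, (exists2 x, x \in J & x != 0) -> fin_dim (alg_quot J).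

End Algebras.

Definition simple_module (R : pzRingType) (M : lmodType R) : Prop :=
  (exists x : M, x != 0) /\
  forall N : set M, submodule N -> N = [set 0] \/ N = setT.

Definition faithful_module (R : pzRingType) (M : lmodType R) : Prop :=
  forall a : R, (forall x : M, a *: x = 0) -> a = 0.

Definition left_primitive (R : pzRingType) : Prop :=
  exists M : lmodType R, simple_module M /\ faithful_module M.

(* Primitive on both sides: right R-modules are left modules over the converse
   ring R^c.  *)
Definition primitive (R : pzRingType) : Prop :=
  left_primitive R /\ left_primitive R^c.

(* The values at 0 of f and g are irrelevant.  *)
Definition growth_equiv (f g : nat -> nat) : Prop :=
  exists C D : nat, [/\ (0 < C)%N, (0 < D)%N &
    forall n, (0 < n)%N -> (f n <= g (C * n) <= f (D * n))%N].

Definition has_growth_type (k : fieldType) (A : algType k) (f : nat -> nat) :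
    Prop :=
  exists (V : set A) (m : nat) (g : nat -> nat),
    [/\ has_dim V m, V 1, generates V,
        forall n, (0 < n)%N -> has_dim (power_space V n) (g n)
      & growth_equiv g f].

Definition word (d : nat) := {fmonom 'I_d}.

Definition free_algebra (k : fieldType) (d : nat) : Type := {malg k[word d]}.

Section FreeAlgebra.
Variables (k : fieldType) (d : nat).

HB.instance Definition _ := GRing.Lalgebra.on (free_algebra k d).

Let free_scaleAr (c : k) (x y : free_algebra k d) : c *: (x * y) = x * (c *: y).
Proof.
apply/malgP => u; rewrite mcoeffZ.
have sub : (msupp (c *: y : {malg k[word d]}) `<=` msupp y)%fset.
  exact: msuppZ_le.
rewrite (mcoeffMlw u (fsubset_refl _) (fsubset_refl _)).
rewrite (mcoeffMlw u (fsubset_refl (msupp x)) sub) mulr_sumr.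
apply: eq_bigr => v _; rewrite mulr_sumr; apply: eq_bigr => w _.
by rewrite mcoeffZ mulrnAr mulrCA.
Qed.

HB.instance Definition _ :=
  GRing.Lalgebra_isAlgebra.Build k (free_algebra k d) free_scaleAr.

Definition monomial (u : word d) : free_algebra k d := << u >>.

End FreeAlgebra.

(* As a [tsideal], I is proper, so the zero algebra is not included.  *)
Definition monomial_algebra (k : fieldType) (A : algType k) : Prop :=
  exists (d : nat) (S : set (word d)) (I : tsideal (free_algebra k d)),
    [set x | x \in I] = ideal_gen [set monomial k u | u in S] /\
    alg_iso A (alg_quot I).

Definition subword (d : nat) (u w : word d) : Prop :=
  exists a b : word d, w = mmul a (mmul u b).

Section BartholdiSmoktunowicz.
Variables (d : nat) (C : nat -> {fset word d}).

(* [C i] and [bs_words i] are the sets C(2^i) and W(2^i).  *)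
Fixpoint bs_words (i : nat) : {fset word d} :=
  if i is j.+1 then [fset mmul u v | u in C j, v in bs_words j]%fset
  else [fset fmu x | x in 'I_d]%fset.

Definition bs_choice (f : nat -> nat) : Prop :=
  forall i, (C i `<=` bs_words i)%fset /\
    (#|` C i|)%:Z = Num.ceil ((f (2 ^ i.+1)%N)%:R / (f (2 ^ i)%N)%:R : rat).

Definition bs_forbidden : set (word d) :=
  [set u | ~ exists i w, w \in bs_words i /\ subword u w].

End BartholdiSmoktunowicz.

Definition bartholdi_smoktunowicz (k : fieldType) (f : nat -> nat)
    (A : algType k) : Prop :=
  exists (C : nat -> {fset word (f 1)}) (I : tsideal (free_algebra k (f 1))),
    [/\ bs_choice C f,
        [set x | x \in I] = ideal_gen [set monomial k u | u in bs_forbidden C]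
      & alg_iso A (alg_quot I)].

(* Main.v *)
(* Let L be the set of factors of the words in W.

   Primitivity: let a be the sum of the letters.  If b(1 - a) = 1, then every
   word of L has coefficient 1 in b, which is absurd; so R(1 - a) is a proper
   left ideal.  When every nonzero two-sided ideal contains all long words, it
   contains some a^n, while 1 - a^n lies in R(1 - a); hence a maximal left
   ideal above R(1 - a) contains no nonzero ideal.  The right-hand side is
   symmetric.

   Nonzero ideals contain all long words: by uniform recurrence one word is
   enough.  A shortest combination of words in the ideal has all its words in
   the same contexts of L, and distinct words cannot have the same contexts,
   since then L would have finitely many syntactic classes, hence contain all
   powers of some word, and its complexity would be bounded.

   Recurrence: (2) makes |C(2^t)| negligible against |W(2^t)|, so that C(2^t)
   can be chosen inside the words with a prescribed factor, for infinitely many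
   t and all factors in turn.

   Growth: (3) gives |W(2^n)| <= K f(2^n), a factor of length at most 2^n lies
   in a word of C(2^n)W(2^n) or W(2^n)C(2^n), and (1) absorbs the powers of 2
   that count the positions and lengths of factors. *)
Require Import Defs.
From HB Require Import structures.
From mathcomp Require Import all_boot all_order all_algebra.
From mathcomp Require Import finmap.
From mathcomp Require Import boolp classical_sets.
From mathcomp Require monalg.
From mathcomp Require Import zify.

Set Implicit Arguments.
Unset Strict Implicit.
Unset Printing Implicit Defensive.

Import Order.TTheory GRing.Theory Num.Theory.
Import Quotient.

Local Open Scope classical_set_scope.
Local Open Scope quotient_scope.
Local Open Scope ring_scope.

Section MonomialAlgebras.
Import monalg.

Local Notation "u ** v" := (mmul u v) (at level 40, left associativity).

(** * Linear algebra *)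

Section LinearAlgebra.
Variables (k : fieldType) (V : lmodType k).

Lemma lspan_submodule (s : seq V) : submodule (lspan s).
Proof.
split; first by exists (fun=> 0); rewrite big1 // => i _; rewrite scale0r.
move=> a x y [c ->] [e ->]; exists (fun i => a * c i + e i).
rewrite scaler_sumr -big_split; apply: eq_bigr => i _.
by rewrite scalerDl scalerA.
Qed.

Lemma submoduleD (N : set V) x y : submodule N -> N x -> N y -> N (x + y).
Proof. by move=> [_ h] Nx Ny; rewrite -[x]scale1r; apply: h. Qed.

Lemma submoduleZ (N : set V) a x : submodule N -> N x -> N (a *: x).
Proof. by move=> [N0 h] Nx; rewrite -[_ *: _]addr0; apply: h. Qed.

Lemma submodule_sum (N : set V) (I : Type) (r : seq I) (P : pred I) F :
  submodule N -> (forall i, P i -> N (F i)) -> N (\sum_(i <- r | P i) F i).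
Proof.
move=> sN h; elim/big_ind: _ => //; first by case: sN.
by move=> x y; apply: submoduleD.
Qed.

Lemma mem_lspan (s : seq V) x : x \in s -> lspan s x.
Proof.
move=> xs; have lt : (index x s < size s)%N by rewrite index_mem.
exists (fun i => (i == Ordinal lt)%:R).
rewrite (bigD1 (Ordinal lt)) //= eqxx scale1r nth_index // big1 ?addr0 //.
by move=> i /negPf->; rewrite scale0r.
Qed.

Lemma lspan_min (s : seq V) (N : set V) :
  submodule N -> (forall x, x \in s -> N x) -> lspan s `<=` N.
Proof.
move=> sN h x [c ->]; apply: submodule_sum => // i _.
by apply: submoduleZ => //; apply/h/mem_nth.
Qed.

Lemma lin_indep_size (s t : seq V) :
  lin_indep s -> (forall x, x \in s -> lspan t x) -> (size s <= size t)%N.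
Proof.
move=> indep_s sub; rewrite leqNgt; apply/negP => lt_ts.
have /choice[M Mdef] : forall i : 'I_(size s), exists c : 'I_(size t) -> k,
    s`_i = \sum_j c j *: t`_j by move=> i; apply/sub/mem_nth.
pose A := \matrix_(i, j) M i j.
have /rowV0Pn[c /sub_kermxP cA c_neq0] : kermx A != 0.
  rewrite kermx_eq0 /row_free; apply/negP => /eqP rA.
  by have := rank_leq_col A; rewrite rA leqNgt lt_ts.
case/eqP: c_neq0; apply/rowP => i; rewrite mxE; move: i.
apply: indep_s; under eq_bigr => i _ do rewrite Mdef scaler_sumr.
rewrite exchange_big big1 // => j _.
under eq_bigr => i _ do rewrite scalerA.
rewrite -scaler_suml; have /rowP/(_ j) := cA; rewrite !mxE => e.
rewrite (_ : \sum_i _ = 0) ?scale0r // -[RHS]e.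
by apply: eq_bigr => i _; rewrite mxE.
Qed.

Lemma lspan_fin_dim (t : seq V) : lspan t = setT -> fin_dim V.
Proof.
move=> tT; pose P n := `[< exists2 s : seq V, size s = n & lin_indep s >].
have exP : exists n, P n.
  by exists 0; apply/asboolP; exists [::] => // c _ [].
have leP n : P n -> (n <= size t)%N.
  case/asboolP=> s <- is_; apply: lin_indep_size is_ _ => x _.
  by rewrite tT.
case: (ex_maxnP exP leP) => n /asboolP[s sz is_] maxn.
exists n, s; split => //; apply/seteqP; split=> // v _.
apply: contrapT => nv.
suff /maxn : P n.+1 by rewrite ltnn.
apply/asboolP; exists (v :: s) => /=; first by rewrite sz.
move=> c; rewrite big_ord_recl /= => e.
have c0 : c ord0 = 0.
  apply: contra_notP nv => /eqP c0.
  exists (fun i => - (c ord0)^-1 * c (lift ord0 i)).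
  under eq_bigr => i _ do rewrite -scalerA.
  rewrite -scaler_sumr; apply: (scalerI c0).
  by rewrite scalerA mulrN divff // scaleN1r; apply/eqP; rewrite -addr_eq0 e.
move=> i; case: (unliftP ord0 i) => [j|] -> //; move: j.
by apply: is_; rewrite -[RHS]e c0 scale0r add0r.
Qed.

Lemma lin_indep_map (T : eqType) (g : T -> V) (s : seq T) : uniq s ->
  (forall c : T -> k, \sum_(t <- s) c t *: g t = 0 ->
     {in s, forall t, c t = 0}) ->
  lin_indep [seq g t | t <- s].
Proof.
case: s => [|t0 s']; first by move=> _ _ c _ [].
move: (t0 :: s') => s us h c.
pose e t := \sum_(i < size (map g s) | val i == index t s) c i.
have eE (i : 'I_(size (map g s))) : e (nth t0 s i) = c i.
  have lt_i : (i < size s)%N by rewrite -(size_map g s).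
  rewrite /e (big_pred1 i) // => j /=.
  by rewrite index_uniq //; apply/eqP/eqP => [/val_inj|->].
move=> c0 i; rewrite -eE; apply: h; last first.
  by rewrite mem_nth // -(size_map g s).
rewrite (big_nth t0) -(size_map g s) big_mkord -[RHS]c0.
apply: eq_bigr => j _; rewrite eE (nth_map t0) //.
by rewrite -(size_map g s).
Qed.

End LinearAlgebra.

(** * A criterion for primitivity *)

Section LeftIdealQuotient.
Variables (A : nzRingType).

(* The proof argument lets the canonical instances below be inferred. *)
Definition lideal_pred (N : set A^o) (_ : submodule N) (x : A) : bool :=
  `[< N x >].

Variables (N : set A^o) (lidealN : submodule N).

Let lideal_zmod_closed : zmod_closed (lideal_pred lidealN).
Proof.
case: lidealN => N0 h; split; first exact/asboolP.
move=> x y /asboolP Nx /asboolP Ny; apply/asboolP.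
by rewrite addrC -mulN1r; apply: (h (-1) y x).
Qed.

HB.instance Definition _ :=
  GRing.isZmodClosed.Build A (lideal_pred lidealN) lideal_zmod_closed.

Let lidealP := GRing.ZmodClosed.clone A (lideal_pred lidealN) _.

Definition lquot : Type := {quot lidealP}.

HB.instance Definition _ := GRing.Zmodule.on lquot.

Definition lpi (x : A) : lquot := \pi_({quot lidealP}) x.

Lemma lpi_eq x y : lpi x = lpi y <-> N (x - y).
Proof.
split=> [/eqP|h]; first by rewrite /lpi piE => /asboolP.
by apply/eqP; rewrite /lpi piE; apply/asboolP.
Qed.

Lemma lpi_repr (q : lquot) : lpi (repr (q : {quot lidealP})) = q.
Proof. exact: reprK. Qed.

Lemma lpiD x y : lpi (x + y) = lpi x + lpi y.
Proof. by rewrite /lpi !piE. Qed.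

Lemma lpi_eq0 x : lpi x = 0 <-> N x.
Proof.
have -> : 0 = lpi 0 by rewrite /lpi piE.
by rewrite lpi_eq subr0.
Qed.

Definition lscale (a : A) (q : lquot) : lquot :=
  lpi (a * repr (q : {quot lidealP})).

Lemma lscaleE a x : lscale a (lpi x) = lpi (a * x).
Proof.
have [N0 h] := lidealN.
rewrite /lscale; apply/lpi_eq; rewrite -mulrBr -[_ * _]addr0.
by apply: h => //; apply/lpi_eq; rewrite lpi_repr.
Qed.

Let lift1 (P : lquot -> Prop) : (forall x, P (lpi x)) -> forall q, P q.
Proof. by move=> h q; rewrite -[q]lpi_repr. Qed.

Let lscaleA a b v : lscale a (lscale b v) = lscale (a * b) v.
Proof. by elim/lift1: v => x; rewrite !lscaleE mulrA. Qed.

Let lscale1 : left_id 1 lscale.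
Proof. by elim/lift1=> x; rewrite lscaleE mul1r. Qed.

Let lscaleDr : right_distributive lscale +%R.
Proof.
by move=> c; elim/lift1=> x; elim/lift1=> y; rewrite -lpiD !lscaleE mulrDr lpiD.
Qed.

Let lscaleDl v : {morph lscale^~ v : a b / a + b}.
Proof. by move=> a b; elim/lift1: v => x; rewrite !lscaleE mulrDl lpiD. Qed.

HB.instance Definition _ := GRing.Zmodule_isLmodule.Build A lquot
  lscaleA lscale1 lscaleDr lscaleDl.

Lemma lpiZ a x : lpi (a * x) = a *: lpi x.
Proof. by rewrite -lscaleE. Qed.

Lemma lquot_simple :
  ~ N 1 -> (forall M : set A^o, submodule M -> N `<=` M -> M = N \/ M 1) ->
  simple_module lquot.
Proof.
move=> N1 maxN; split; first by exists (lpi 1); apply/eqP => /lpi_eq0.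
move=> M [M0 hM].
have [||e|M1] := maxN [set x | M (lpi x)].
- split=> /=; first by rewrite (lpi_eq0 0).2 //; case: lidealN.
  by move=> a x y /= Mx My; rewrite lpiD lpiZ; apply: hM.
- by move=> x /lpi_eq0 /= ->.
- left; apply/seteqP; split=> [q|q ->] //=; elim/lift1: q => x Mx.
  by apply/lpi_eq0; rewrite -e.
- right; apply/seteqP; split=> // q _; elim/lift1: q => x.
  by rewrite -[x]mulr1 lpiZ -[_ *: _]addr0; apply: hM.
Qed.

End LeftIdealQuotient.

Section Primitivity.
Variable A : nzRingType.

Lemma ex_maximal_lideal (N : set A^o) : submodule N -> ~ N 1 ->
  exists M : set A^o, [/\ submodule M, N `<=` M, ~ M 1 &
    forall M' : set A^o, submodule M' -> M `<=` M' -> M' = M \/ M' 1].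
Proof.
move=> sN N1.
pose good (M : set A^o) := [/\ submodule M, N `<=` M & ~ M 1].
have [F FP totF|M [MP maxM]] := @Zorn_bigcup A^o [set M | M = set0 \/ good M].
  have [[M0 FM0 gM0]|nogood] := pselect (exists2 M, F M & good M); last first.
    left; apply/seteqP; split=> // x [M FM Mx].
    have [M0|gM] := FP _ FM; first by rewrite M0 in Mx.
    by case: nogood; exists M.
  right; split.
  - split; first by exists M0 => //; case: gM0 => -[].
    move=> a x y [M1 F1 x1] [M2 F2 y2].
    have [M [FM Mx My]] : exists M, [/\ F M, M x & M y].
      by case: (totF _ _ F1 F2) => h; [exists M2|exists M1]; split=> //; apply: h.
    have [e|[[_ h] _ _]] := FP _ FM; first by rewrite e in Mx.
    by exists M => //; apply: h.
  - by move=> x Nx; exists M0 => //; case: gM0 => _ h _; apply: h.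
  - move=> [M FM M1]; have [e|[_ _ //]] := FP _ FM; by rewrite e in M1.
have [e|[sM NM M1]] := MP.
  case: (maxM N); last by right; split.
  by rewrite e; split=> //; case: sN => N0 _ /(_ 0 N0).
exists M; split=> // M' sM' sub; have [|nM'1] := pselect (M' 1); first by right.
left; apply: contrapT => ne; case: (maxM M').
  split=> // sub'; apply: ne.
  exact/seteqP.
by right; split=> // x /NM /sub.
Qed.

(* A(1 - a) contains 1 - a^n, so it is comaximal with every nonzero ideal, and
   so is every maximal left ideal above it. *)
Lemma left_primitive_criterion (a : A) :
  (forall b, b * (1 - a) <> 1) ->
  (forall J : set A, two_sided J -> (exists2 x, J x & x != 0) ->
     exists n, J (a ^+ n)) ->
  left_primitive A.
Proof.
move=> a1 aJ.
pose N : set A^o := [set x | exists b, x = b * (1 - a)].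
have sN : submodule N.
  split; first by exists 0; rewrite mul0r.
  by move=> c x y [b ->] [b' ->]; exists (c * b + b'); rewrite mulrDl -mulrA.
have [|M [sM NM M1 maxM]] := ex_maximal_lideal sN; first by case=> b /esym/a1.
exists (lquot sM); split; first exact: lquot_simple.
move=> r r0; apply: contrapT => /eqP r_neq0.
pose J : set A := [set x | forall v : lquot sM, x *: v = 0].
have [||n Jn] := aJ J; last 1 first.
- apply/M1/(lpi_eq0 sM); rewrite -[RHS](Jn (lpi sM 1)) -lpiZ mulr1.
  apply/lpi_eq/NM.
  elim: n {Jn} => [|n IHn]; first by rewrite expr0 subrr; case: sN.
  have -> : 1 - a ^+ n.+1 = a * (1 - a ^+ n) + (1 - a).
    by rewrite mulrBr mulr1 -exprS [RHS]addrC addrA subrK.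
  by apply: sN.2 => //; exists 1; rewrite mul1r.
- split=> [v|x y Jx Jy v|b x Jx]; first by rewrite scale0r.
    by rewrite scalerBl Jx Jy subr0.
  split=> v; first by rewrite -scalerA Jx scaler0.
  by rewrite -scalerA Jx.
- by exists r.
Qed.

End Primitivity.

(** * Words and the free algebra *)

Section Words.
Variable d : nat.
Implicit Types u v w p q : word d.

Lemma wordP u v : u = v :> seq 'I_d <-> u = v.
Proof. by split=> [h|-> //]; apply/eqP; rewrite fmP; apply/eqP. Qed.

Lemma wordM u v : u ** v = u ++ v :> seq 'I_d.
Proof. exact: fmM. Qed.

Lemma size_wordM u v : @size 'I_d (u ** v) = (@size 'I_d u + @size 'I_d v)%N.
Proof. by rewrite wordM size_cat. Qed.

Lemma mulm_injl u : injective (mmul u).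
Proof.
move=> v w /wordP; rewrite !wordM => /eqP; rewrite eqseq_cat // eqxx /=.
by move=> /eqP/wordP.
Qed.

Lemma mulm_injr v : injective (mmul^~ v).
Proof.
move=> u w /wordP/=; rewrite !wordM => e; apply/wordP/eqP.
have eqs : size u = size w.
  by move/(congr1 size): e; rewrite !size_cat => /addIn.
by move/eqP: e; rewrite eqseq_cat // => /andP[].
Qed.

Lemma word_indl (P : word d -> Prop) :
  P mone -> (forall i u, P u -> P (fmu i ** u)) -> forall u, P u.
Proof.
move=> P1 PS [s]; elim: s => [|i s IHs].
  by rewrite (_ : FMonom _ = mone) //; apply/wordP; rewrite fm1.
rewrite (_ : FMonom _ = fmu i ** FMonom s); first exact: PS.
by apply/wordP; rewrite wordM fmU.
Qed.

Lemma word_indr (P : word d -> Prop) :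
  P mone -> (forall i u, P u -> P (u ** fmu i)) -> forall u, P u.
Proof.
move=> P1 PS [s]; elim/last_ind: s => [|s i IHs].
  by rewrite (_ : FMonom _ = mone) //; apply/wordP; rewrite fm1.
rewrite (_ : FMonom _ = FMonom s ** fmu i); first exact: PS.
by apply/wordP; rewrite wordM fmU cats1.
Qed.

Lemma subword_refl u : subword u u.
Proof. by exists mone, mone; rewrite mulm1 mul1m. Qed.

Lemma subword_trans v u w : subword u v -> subword v w -> subword u w.
Proof.
move=> [a [b ->]] [a' [b' ->]]; exists (a' ** a), (b ** b').
by rewrite !mulmA.
Qed.

Lemma subwordl u v : subword u (u ** v).
Proof. by exists mone, v; rewrite mul1m. Qed.

Lemma subwordr u v : subword v (u ** v).
Proof. by exists u, mone; rewrite mulm1. Qed.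

Definition words_upto (n : nat) : seq (word d) :=
  undup (flatten
    [seq [seq FMonom (val t) | t : m.-tuple 'I_d] | m <- iota 0 n.+1]).

Lemma mem_words_upto n u : (u \in words_upto n) = (size u <= n)%N.
Proof.
rewrite mem_undup; apply/flatten_mapP/idP => [[m]|le_un].
  rewrite mem_iota ltnS => /andP[_ le_mn] /mapP[t _ ->] /=.
  by rewrite size_tuple.
exists (size u); first by rewrite mem_iota ltnS.
by apply/mapP; exists (in_tuple u); rewrite ?mem_enum // fmK.
Qed.

Lemma uniq_words_upto n : uniq (words_upto n).
Proof. exact: undup_uniq. Qed.

End Words.

Section Coefficients.
Variables (k : fieldType) (d : nat).
Local Notation F := (free_algebra k d).
Local Notation mon := (monomial k).
Implicit Types (u v w : word d) (x y : F).

Definition coef u x : k := mcoeff u x.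

Lemma coef0 u : coef u 0 = 0. Proof. exact: mcoeff0. Qed.
Lemma coefD u x y : coef u (x + y) = coef u x + coef u y.
Proof. exact: mcoeffD. Qed.
Lemma coefB u x y : coef u (x - y) = coef u x - coef u y.
Proof. exact: mcoeffB. Qed.
Lemma coefZ u a x : coef u (a *: x) = a * coef u x.
Proof. exact: mcoeffZ. Qed.
Lemma coef_mon u v : coef u (mon v) = (v == u)%:R.
Proof. exact: mcoeffU1. Qed.
Lemma coef1 u : coef u 1 = (u == mone)%:R.
Proof. exact: mcoeff1. Qed.

Lemma monM u v : mon (u ** v) = mon u * mon v.
Proof.
rewrite /monomial; apply/malgP => w.
rewrite (mcoeffMlw w (fsubset_refl _) (fsubset_refl _)) !msuppU1 !big_seq_fset1.
by rewrite !mcoeffU1 !eqxx mul1r.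
Qed.

Lemma mon1 : mon mone = 1 :> F. Proof. by []. Qed.

Lemma free_sum x : x = \sum_(u <- msupp x) coef u x *: mon u.
Proof.
rewrite {1}[x]monalgE; apply: eq_bigr => u _; apply/malgP => v.
by rewrite mcoeffU [RHS]mcoeffZ mcoeffU1 mulr_natr.
Qed.

Lemma free_ind (N : set F) :
  submodule N -> (forall u, N (mon u)) -> forall x, N x.
Proof.
move=> sN h x; rewrite (free_sum x); apply: submodule_sum => // u _.
exact: submoduleZ.
Qed.

Lemma linear_ext (g h : F -> k) :
  (forall a x y, g (a *: x + y) = a * g x + g y) ->
  (forall a x y, h (a *: x + y) = a * h x + h y) ->
  (forall u, g (mon u) = h (mon u)) -> forall x, g x = h x.
Proof.
move=> lg lh gh; have g0 (f : F -> k) :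
    (forall a x y, f (a *: x + y) = a * f x + f y) -> f 0 = 0.
  by move=> lf; have := lf (-1) 0 0; rewrite scaler0 addr0 mulN1r addNr.
apply: free_ind => //; split=> [|a x y /= ex ey] /=; first by rewrite !g0.
by rewrite lg lh ex ey.
Qed.

Lemma coef_linear_mull w y a x x' :
  coef w (y * (a *: x + x')) = a * coef w (y * x) + coef w (y * x').
Proof. by rewrite mulrDr -scalerAr coefD coefZ. Qed.

Lemma coef_linear_mulr w y a x x' :
  coef w ((a *: x + x') * y) = a * coef w (x * y) + coef w (x' * y).
Proof. by rewrite mulrDl -scalerAl coefD coefZ. Qed.

Lemma coef_linear w a x y : coef w (a *: x + y) = a * coef w x + coef w y.
Proof. by rewrite coefD coefZ. Qed.

Lemma coef_monMl v u x : coef (v ** u) (mon v * x) = coef u x.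
Proof.
move: x; apply: linear_ext => [||w]; first exact: coef_linear_mull.
  exact: coef_linear.
by rewrite -monM !coef_mon (inj_eq (@mulm_injl _ v)).
Qed.

Lemma coef_monMr v u x : coef (u ** v) (x * mon v) = coef u x.
Proof.
move: x; apply: linear_ext => [||w]; first exact: coef_linear_mulr.
  exact: coef_linear.
by rewrite -monM !coef_mon (inj_eq (@mulm_injr _ v)).
Qed.

Lemma coef_monMl0 v w x : (forall u, w <> v ** u) -> coef w (mon v * x) = 0.
Proof.
move=> ne; move: x; apply: (linear_ext (h := fun=> 0)) => [|a _ _|u].
- exact: coef_linear_mull.
- by rewrite mulr0 addr0.
by rewrite -monM coef_mon; case: eqP => // /esym/ne.
Qed.

Lemma coef_monMr0 v w x : (forall u, w <> u ** v) -> coef w (x * mon v) = 0.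
Proof.
move=> ne; move: x; apply: (linear_ext (h := fun=> 0)) => [|a _ _|u].
- exact: coef_linear_mulr.
- by rewrite mulr0 addr0.
by rewrite -monM coef_mon; case: eqP => // /esym/ne.
Qed.

Lemma coef_mull0 w y x : (forall v u, w = v ** u -> coef u x = 0) ->
  coef w (y * x) = 0.
Proof.
move=> h; move: y; apply: (linear_ext (h := fun=> 0)) => [|a _ _|v].
- exact: coef_linear_mulr.
- by rewrite mulr0 addr0.
have [[u e]|ne] := pselect (exists u, w = v ** u).
  by rewrite e coef_monMl (h _ _ e).
by apply: coef_monMl0 => u e; case: ne; exists u.
Qed.

Lemma coef_mulr0 w y x : (forall u v, w = u ** v -> coef u x = 0) ->
  coef w (x * y) = 0.
Proof.
move=> h; move: y; apply: (linear_ext (h := fun=> 0)) => [|a _ _|v].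
- exact: coef_linear_mull.
- by rewrite mulr0 addr0.
have [[u e]|ne] := pselect (exists u, w = u ** v).
  by rewrite e coef_monMr (h _ _ e).
by apply: coef_monMr0 => u e; case: ne; exists u.
Qed.

End Coefficients.

(** * Monomial algebras *)

Record language (d : nat) := Language {
  lang :> word d -> Prop;
  lang1 : lang mone;
  lang_sub : forall u w, subword u w -> lang w -> lang u
}.

Section MonomialQuotient.
Variables (k : fieldType) (d : nat) (L : language d).
Local Notation F := (free_algebra k d).
Local Notation mon := (monomial k).
Implicit Types (u v w : word d) (x y : F).

Definition mono_pred x : bool := `[< forall u, L u -> coef u x = 0 >].

Let mono_idealr : idealr_closed mono_pred.
Proof.
split; [| |move=> a x y /asboolP x0 /asboolP y0]; rewrite /in_mem /=.
- by apply/asboolP => u _; rewrite coef0.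
- apply/negP => /asboolP/(_ _ (lang1 L))/eqP.
  by rewrite coef1 eqxx oner_eq0.
- apply/asboolP => w Lw; rewrite coefD y0 // addr0.
  apply: coef_mull0 => v u e; apply: x0.
  by apply: lang_sub Lw; rewrite e; apply: subwordr.
Qed.

HB.instance Definition _ := isIdealr.Build F mono_pred mono_idealr.

Let mono_idealMr a : {in mono_pred, forall x, x * a \in mono_pred}.
Proof.
move=> x /asboolP x0; apply/asboolP => w Lw.
apply: coef_mulr0 => u v e; apply: x0.
by apply: lang_sub Lw; rewrite e; apply: subwordl.
Qed.

HB.instance Definition _ := isMulrClosedIdeal.Build F mono_pred mono_idealMr.

Definition mono_ideal : tsideal F := TsIdeal.clone F mono_pred _.

Lemma mono_idealE :
  [set x | x \in mono_ideal] =
  ideal_gen [set monomial k u | u in [set u | ~ L u]].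
Proof.
apply/seteqP; split=> [x /asboolP x0 J [[J0 JB JM] sJ]|].
  have JD a b : J a -> J b -> J (a + b).
    by move=> Ja Jb; rewrite -[b]opprK -[- b]add0r; apply/JB/JB.
  rewrite (free_sum x); elim/big_rec: _ => // u y _ Jy; apply: JD => //.
  have [/x0 ->|nLu] := pselect (L u); first by rewrite scale0r.
  by rewrite -mulr_algl; apply: (JM _ _ _).1; apply: sJ; exists u.
apply: smallest_sub => /=; last first.
  move=> _ [u nLu <-]; apply/asboolP => v Lv.
  by rewrite coef_mon; case: eqP => // e; rewrite e in nLu.
split; first exact: rpred0.
  by move=> x y; apply: rpredB.
by move=> a x xI; split; [apply: idealMr|apply: mono_idealMr].
Qed.

Definition mono_alg : algType k := alg_quot mono_ideal.
Local Notation R := mono_alg.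

Definition mono_word u : R := alg_pi mono_ideal (mon u).

Lemma mono_wordM u v : mono_word (u ** v) = mono_word u * mono_word v.
Proof. by rewrite /mono_word monM rmorphM. Qed.

Lemma mono_word1 : mono_word mone = 1.
Proof. by rewrite /mono_word mon1 rmorph1. Qed.

Lemma alg_pi_eq x y :
  alg_pi mono_ideal x = alg_pi mono_ideal y <->
  (forall u, L u -> coef u x = coef u y).
Proof.
split=> [/eqP|e].
  rewrite alg_piP => /asboolP h u /h; rewrite coefB => /eqP.
  by rewrite subr_eq0 => /eqP.
apply/eqP; rewrite alg_piP; apply/asboolP => u Lu.
by rewrite coefB e // subrr.
Qed.

Lemma mono_word_eq0 u : ~ L u -> mono_word u = 0.
Proof.
move=> nLu; rewrite -(rmorph0 (alg_pi mono_ideal)); apply/alg_pi_eq => v Lv.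
by rewrite coef0 coef_mon; case: eqP => // e; rewrite e in nLu.
Qed.

Definition mono_coef u (r : R) : k := coef u (alg_rep r).

Lemma mono_coefE u x : L u -> mono_coef u (alg_pi mono_ideal x) = coef u x.
Proof. by move: u; apply/alg_pi_eq; rewrite alg_repK. Qed.

Lemma mono_coef_linear u a (r r' : R) : L u ->
  mono_coef u (a *: r + r') = a * mono_coef u r + mono_coef u r'.
Proof.
move=> Lu; have [x <-] := alg_pi_surj r; have [y <-] := alg_pi_surj r'.
by rewrite -linearZ -rmorphD !mono_coefE // coef_linear.
Qed.

Lemma mono_coef_word u v : L u -> mono_coef u (mono_word v) = (v == u)%:R.
Proof. by move=> Lu; rewrite mono_coefE // coef_mon. Qed.

Lemma mono_word_expand (r : R) : exists s : seq (word d),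
  [/\ uniq s, forall u, u \in s -> L u &
      r = \sum_(u <- s) mono_coef u r *: mono_word u].
Proof.
have [x <-] := alg_pi_surj r.
exists [seq u <- msupp x | `[< L u >]]; split.
- exact/filter_uniq/fset_uniq.
- by move=> u; rewrite mem_filter => /andP[/asboolP].
rewrite big_filter [RHS]big_mkcond {1}[x]free_sum rmorph_sum /=.
apply: eq_bigr => u _; rewrite linearZ /=.
case: asboolP => [Lu|nLu]; first by rewrite mono_coefE.
by rewrite [X in _ *: X](mono_word_eq0 nLu) scaler0.
Qed.

Lemma mono_alg_monomial : monomial_algebra R.
Proof.
exists d, [set u | ~ L u], mono_ideal; split; first exact: mono_idealE.
by exists (GRing.LRMorphism.clone k R R *:%R idfun _); exists idfun.
Qed.

End MonomialQuotient.

(* The coefficient [cf u] is only specified for words [u] of [L]. *)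
Record word_basis (k : fieldType) (d : nat) (L : language d) (R : algType k) :=
  WordBasis {
  wd : word d -> R;
  cf : word d -> R -> k;
  wd1 : wd mone = 1;
  wdM : forall u v, wd (u ** v) = wd u * wd v;
  wd_eq0 : forall u, ~ L u -> wd u = 0;
  wd_expand : forall r, exists s : seq (word d),
    [/\ uniq s, forall u, u \in s -> L u & r = \sum_(u <- s) cf u r *: wd u];
  cf_linear : forall u a r r', L u -> cf u (a *: r + r') = a * cf u r + cf u r';
  cf_wd : forall u v, L u -> cf u (wd v) = (v == u)%:R
}.

Lemma mono_alg_word_basis (k : fieldType) (d : nat) (L : language d) :
  word_basis L (mono_alg k L).
Proof.
exact: (WordBasis (@mono_word1 k d L) (@mono_wordM k d L) (@mono_word_eq0 k d L)
  (@mono_word_expand k d L) (@mono_coef_linear k d L) (@mono_coef_word k d L)).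
Defined.

Section WordBasisTheory.
Variables (k : fieldType) (d : nat) (L : language d) (R : algType k).
Variable B : word_basis L R.
Local Notation wd := (wd B).
Local Notation cf := (cf B).
Local Notation wd1 := (wd1 B).
Local Notation wdM := (wdM B).
Local Notation wd_eq0 := (wd_eq0 B).
Local Notation wd_expand := (wd_expand B).
Local Notation cf_linear := (cf_linear B).
Local Notation cf_wd := (cf_wd B).
Implicit Types (u v w : word d) (x y r : R).

Lemma cf0 u : L u -> cf u 0 = 0.
Proof.
move=> Lu; have := cf_linear (-1) 0 0 Lu.
by rewrite scaler0 addr0 mulN1r addNr.
Qed.

Lemma cfD u x y : L u -> cf u (x + y) = cf u x + cf u y.
Proof. by move=> Lu; have := cf_linear 1 x y Lu; rewrite scale1r mul1r. Qed.

Lemma cfZ u a x : L u -> cf u (a *: x) = a * cf u x.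
Proof.
by move=> Lu; rewrite -[a *: x]addr0 cf_linear // cf0 // addr0.
Qed.

Lemma cf_sum u (I : Type) (s : seq I) (F : I -> R) : L u ->
  cf u (\sum_(i <- s) F i) = \sum_(i <- s) cf u (F i).
Proof.
move=> Lu; elim/big_rec2: _ => [|i a b _ <-]; first exact: cf0.
by rewrite cfD.
Qed.

Lemma wd_ind (N : set R) :
  submodule N -> (forall u, L u -> N (wd u)) -> forall r, N r.
Proof.
move=> sN h r; have [s [_ sL ->]] := wd_expand r.
rewrite big_seq; apply: submodule_sum => // u /sL Lu.
by apply: submoduleZ => //; apply: h.
Qed.

Lemma wd_lin_indep (s : seq (word d)) :
  uniq s -> (forall u, u \in s -> L u) -> lin_indep [seq wd u | u <- s].
Proof.
move=> us sL; apply: lin_indep_map => // c c0 u us'.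
have := congr1 (cf u) c0; rewrite cf_sum ?cf0; try exact: sL.
rewrite (bigD1_seq u) //= cfZ ?cf_wd; try exact: sL.
rewrite eqxx mulr1 big1 ?addr0 // => v vu.
by rewrite cfZ ?cf_wd ?(negPf vu) ?mulr0 //; exact: sL.
Qed.
Definition lwords (n : nat) : seq (word d) :=
  [seq u <- words_upto d n | `[< L u >]].

Lemma mem_lwords n u : u \in lwords n <-> L u /\ (size u <= n)%N.
Proof.
rewrite mem_filter mem_words_upto; split; first by move=> /andP[/asboolP].
by move=> [/asboolP -> ->].
Qed.

Lemma uniq_lwords n : uniq (lwords n).
Proof. exact/filter_uniq/uniq_words_upto. Qed.

Definition lspace n : set R := lspan [seq wd u | u <- lwords n].

Lemma mem_lspace n u : (size u <= n)%N -> lspace n (wd u).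
Proof.
move=> le_un; have [Lu|/wd_eq0 ->] := pselect (L u).
  by apply/mem_lspan/map_f; apply/mem_lwords.
by case: (lspan_submodule [seq wd u | u <- lwords n]).
Qed.

Lemma lspace_dim n : has_dim (lspace n) (size (lwords n)).
Proof.
exists [seq wd u | u <- lwords n]; rewrite size_map; split=> //.
apply: wd_lin_indep; first exact: uniq_lwords.
by move=> u /mem_lwords[].
Qed.

Lemma lspaceM m n x y :
  lspace m x -> lspace n y -> lspace (m + n) (x * y).
Proof.
have sL j := lspan_submodule [seq wd u | u <- lwords j].
move=> mx ny; move: x mx.
apply: (lspan_min (N := [set x | lspace (m + n) (x * y)])).
  split=> [|c a b /= na nb] /=; first by rewrite mul0r; case: (sL (m + n)%N).
  rewrite mulrDl -scalerAl; exact: (sL _).2 na nb.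
move=> _ /mapP[u /mem_lwords[_ le_um] ->] /=.
move: y ny; apply: (lspan_min (N := [set y | lspace (m + n) (wd u * y)])).
  split=> [|c a b /= na nb] /=; first by rewrite mulr0; case: (sL (m + n)%N).
  rewrite mulrDr -scalerAr; exact: (sL _).2 na nb.
move=> _ /mapP[v /mem_lwords[_ le_vn] ->] /=; rewrite -wdM.
by apply: mem_lspace; rewrite size_wordM leq_add.
Qed.

Lemma lspace_prod n (v : 'I_n -> R) :
  (forall i, lspace 1 (v i)) -> lspace n (\prod_(i < n) v i).
Proof.
elim: n v => [|n IHn] v hv.
  by rewrite big_ord0 -wd1; apply: mem_lspace; rewrite fm1.
rewrite big_ord_recl; apply: (@lspaceM 1 n) => //; exact: IHn.
Qed.

Lemma wd_prod n u : (size u <= n)%N ->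
  exists v : nat -> R, (forall i, lspace 1 (v i)) /\ wd u = \prod_(i < n) v i.
Proof.
move: u n; apply: word_indl => [n _|i u IHu [|n]].
- exists (fun=> 1); rewrite big1 // wd1; split=> // _.
  by rewrite -wd1; apply: mem_lspace; rewrite fm1.
- by rewrite size_wordM fmU.
rewrite size_wordM fmU add1n ltnS => /IHu[v [hv e]].
exists (fun j => if j is j'.+1 then v j' else wd (fmu i)); split.
  by case=> [|j]; [apply: mem_lspace; rewrite fmU|apply: hv].
by rewrite wdM big_ord_recl e.
Qed.

Lemma power_lspace n : power_space (lspace 1) n = lspace n.
Proof.
apply/seteqP; split.
  apply: smallest_sub; first exact: lspan_submodule.
  by move=> _ [v [hv ->]]; apply: lspace_prod.
move=> x nx P [sP sub]; move: x nx; apply: lspan_min => //.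
move=> _ /mapP[u /mem_lwords[_ /wd_prod[v [hv e]]] ->]; apply: sub.
by exists (fun i => v i).
Qed.

Lemma subalgebra_setT (S : set R) :
  subalgebra S -> (forall i, S (wd (fmu i))) -> S = setT.
Proof.
move=> [sS S1 SM] Sl; apply/seteqP; split=> // r _.
move: r; apply: wd_ind => // u _; move: u; apply: word_indl.
  by rewrite wd1.
by move=> i u Su; rewrite wdM; apply: SM.
Qed.

Lemma generates_letters (X : set R) : (forall i, X (wd (fmu i))) -> generates X.
Proof.
move=> hX; apply/seteqP; split=> // r _ S [sS sub].
by rewrite (subalgebra_setT sS) // => i; apply: sub.
Qed.

Lemma word_basis_fin_generated : fin_generated R.
Proof.
exists [seq wd (fmu i) | i : 'I_d]; apply: generates_letters => i.
rewrite /= /image_mem; apply: map_f; exact: mem_enum.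
Qed.


Lemma word_basis_growth (f : nat -> nat) :
  growth_equiv (fun n => size (lwords n)) f -> has_growth_type R f.
Proof.
move=> gf; exists (lspace 1), (size (lwords 1)), (fun n => size (lwords n)).
split=> //.
- exact: lspace_dim.
- by rewrite -wd1; apply: mem_lspace; rewrite fm1.
- by apply: generates_letters => i; apply: mem_lspace; rewrite fmU.
- by move=> n _; rewrite power_lspace; apply: lspace_dim.
Qed.

End WordBasisTheory.

(** * Words with the same contexts *)

Section BijectiveNumeration.
Variable d : nat.
Implicit Types s t : seq 'I_d.

(* The value of s in bijective base d, with digits 1, ..., d; it orders words
   by length first and then lexicographically. *)
Definition wval s : nat := foldl (fun a (i : 'I_d) => a * d + i.+1)%N 0%N s.

Lemma wval_rcons s i : wval (rcons s i) = (wval s * d + i.+1)%N.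
Proof. by rewrite /wval -cats1 foldl_cat. Qed.

Lemma wval_cat s t : wval (s ++ t) = (wval s * d ^ size t + wval t)%N.
Proof.
elim/last_ind: t => [|t i IHt]; first by rewrite cats0 muln1 addn0.
by rewrite -rcons_cat !wval_rcons IHt size_rcons expnSr mulnDl mulnA addnA.
Qed.

Lemma wval_inj : injective wval.
Proof.
elim/last_ind => [|s i IHs] t; case/lastP: t => [|t j] //; rewrite !wval_rcons.
- by rewrite addnS.
- by rewrite addnS.
rewrite !addnS => -[e].
have d_gt0 : (0 < d)%N by apply: leq_trans (ltn_ord i).
have e1 := congr1 (fun m => m %/ d)%N e.
have e2 := congr1 (fun m => m %% d)%N e.
rewrite !divnMDl // !divn_small // !addn0 in e1.
rewrite !modnMDl !modn_small // in e2.
by rewrite (IHs _ e1) (val_inj e2).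
Qed.

Lemma wval_size s t : (size s < size t)%N -> (wval s < wval t)%N.
Proof.
elim/last_ind: s t => [|s i IHs] t; case/lastP: t => [|t j] //.
  by rewrite wval_rcons addnS.
rewrite !size_rcons ltnS => /IHs lt_st; rewrite !wval_rcons.
have := ltn_ord i; nia.
Qed.

Lemma wval_ltP s t : (wval s < wval t)%N -> (size s <= size t)%N.
Proof. by apply: contraTT; rewrite -!leqNgt -ltnNge => /wval_size/ltnW. Qed.

Lemma wval_context p q s t : (wval s < wval t)%N ->
  (wval (p ++ s ++ q) < wval (p ++ t ++ q))%N.
Proof.
move=> lt_st; have le_st := wval_ltP lt_st.
have [d0|d_gt0] := posnP d.
  by case: t lt_st le_st => [|i t] // _ _; have := ltn_ord i; lia.
rewrite !wval_cat !size_cat !expnD !addnA ltn_add2r !mulnA -!mulnDl.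
rewrite ltn_pmul2r ?expn_gt0 ?d_gt0 //.
apply: leq_ltn_trans (_ : _ <= wval p * d ^ size t + wval s)%N _.
  by rewrite leq_add2r leq_mul2l leq_pexp2l ?orbT.
by rewrite ltn_add2l.
Qed.

End BijectiveNumeration.

Section Congruence.
Variables (d : nat) (L : language d).
Implicit Types (u v w p q z : word d).

Definition uniformly_recurrent : Prop :=
  forall u, L u -> exists N, forall w, L w -> (N <= size w)%N -> subword u w.

Definition unbounded_complexity : Prop :=
  forall m, exists n (s : seq (word d)),
    [/\ uniq s, (m < size s)%N & forall u, u \in s -> L u /\ size u = n].

Definition congruent u v : Prop :=
  forall p q, L (p ** u ** q) <-> L (p ** v ** q).

Lemma congruent_sym u v : congruent u v -> congruent v u.
Proof. by move=> h p q; split=> /h. Qed.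

Lemma congruent_trans v u w : congruent u v -> congruent v w -> congruent u w.
Proof. by move=> h1 h2 p q; rewrite h1. Qed.

Lemma congruentM p q u v :
  congruent u v -> congruent (p ** u ** q) (p ** v ** q).
Proof.
move=> h p' q'; rewrite !mulmA.
by have := h (p' ** p) (q ** q'); rewrite !mulmA.
Qed.

Lemma congruent_lang u v : congruent u v -> L u -> L v.
Proof. by move=> /(_ mone mone); rewrite !mulm1 !mul1m => ->. Qed.

Lemma lang_long : unbounded_complexity -> forall n, exists2 u, L u & size u = n.
Proof.
move=> uc n; have [l [s [us lt_s hs]]] := uc (size (words_upto d n)).
have [[u us' lt_nu]|short] := pselect (exists2 u, u \in s & (n < size u)%N).
  exists (FMonom (take n u)); last by rewrite /= size_take lt_nu.
  apply: lang_sub (hs _ us').1; exists mone, (FMonom (drop n u)).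
  by rewrite mul1m; apply/wordP; rewrite wordM cat_take_drop.
suff : (size s <= size (words_upto d n))%N by rewrite leqNgt lt_s.
apply: uniq_leq_size => // u us'; rewrite mem_words_upto leqNgt.
apply/negP => lt_nu.
by apply: short; exists u.
Qed.

Hypotheses (recL : uniformly_recurrent) (ucL : unbounded_complexity).

Definition wpow z n : word d := iter n (mmul z) mone.

Lemma size_wpow z n : size (wpow z n) = (n * size z)%N.
Proof. by elim: n => [|n IHn]; rewrite ?fm1 // size_wordM IHn mulSn. Qed.

Lemma nth_wpow i0 z n j : (j < n * size z)%N ->
  nth i0 (wpow z n) j = nth i0 z (j %% size z).
Proof.
elim: n j => [|n IHn] j // lt_j; rewrite [wpow _ _]/= wordM nth_cat.
case: ltnP => [lt_jz|le_zj]; first by rewrite modn_small.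
rewrite IHn; last by rewrite ltn_subLR // -mulSn.
by rewrite -{2}(subnK le_zj) modnDr.
Qed.

Lemma no_wpow z : z <> mone -> exists n, ~ L (wpow z n).
Proof.
move=> z1; apply: contrapT => noL.
have Lz n : L (wpow z n) by apply: contrapT => h; apply: noL; exists n.
have z_gt0 : (0 < size z)%N.
  by rewrite lt0n; apply/eqP => /size0nil e; apply/z1/wordP; rewrite e fm1.
have [l [s [us lt_s hs]]] := ucL (size z).
have [i0 _] : exists i0 : 'I_d, True by case: (z) z_gt0 => -[|i0] //; exists i0.
pose f r := FMonom (mkseq (fun j => nth i0 z ((r + j) %% size z)) l).
suff : (size s <= size [seq f r | r <- iota 0 (size z)])%N.
  by rewrite size_map size_iota leqNgt lt_s.
apply: uniq_leq_size => // u /hs[Lu su].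
have [N hN] := recL Lu.
have [a [b e]] : subword u (wpow z N).
  by apply: hN => //; rewrite size_wpow leq_pmulr.
have -> : u = f (size a %% size z)%N.
  apply/wordP/(@eq_from_nth _ i0); rewrite /= ?size_mkseq // su => j lt_jl.
  rewrite nth_mkseq // modnDml -(nth_wpow i0 (n := N)).
    by rewrite e !wordM nth_cat ltnNge leq_addr /= addKn nth_cat su lt_jl.
  rewrite -size_wpow e !size_wordM ltn_add2l su.
  by apply: leq_trans lt_jl _; rewrite leq_addr.
by apply: map_f; rewrite mem_iota ltn_mod.
Qed.

(* If u1 is congruent to u2 and precedes it, replacing u2 by u1 decreases wval,
   so every word of L is congruent to one avoiding u2, which is short by
   recurrence.  Hence there are finitely many congruence classes, two prefixes
   p and p ** z of a long word are congruent, and L contains all powers of z. *)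
Lemma congruent_eq u1 u2 : L u1 -> L u2 -> congruent u1 u2 -> u1 = u2.
Proof.
wlog lt12 : u1 u2 / (wval u1 < wval u2)%N.
  move=> hwlog L1 L2 h; case: (ltngtP (wval u1) (wval u2)) => [lt|lt|].
  - exact: hwlog.
  - by apply/esym/hwlog => //; apply: congruent_sym.
  - by move/wval_inj/wordP.
move=> L1 L2 h12; exfalso; have [N hN] := recL L2.
have short w : L w -> exists2 w' : word d, (size w' <= N)%N & congruent w w'.
  have [m le_m] := ubnP (wval w); elim: m w le_m => // m IHm w le_m Lw.
  have [/(hN _ Lw)[p [q e]]|/ltnW le_wN] := leqP N (size w); last by exists w.
  have cw : congruent w (p ** u1 ** q).
    by rewrite e mulmA; apply/congruentM/congruent_sym.
  have [||w' le_w' cw'] := IHm (p ** u1 ** q).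
  - rewrite ltnS in le_m; apply: leq_trans _ le_m; rewrite e -mulmA !wordM.
    exact: wval_context.
  - exact: congruent_lang cw _.
  - by exists w' => //; apply: congruent_trans cw _.
pose M := size (words_upto d N).
have [W LW sW] := lang_long ucL M.
pose P (i : 'I_M.+1) : word d := FMonom (take i W).
have LP i : L (P i).
  apply: lang_sub LW; exists mone, (FMonom (drop i W)); rewrite mul1m.
  by apply/wordP; rewrite wordM cat_take_drop.
have /choice[f hf] : forall i, exists w' : word d,
    (size w' <= N)%N /\ congruent (P i) w'.
  by move=> i; have [w' le_w' cw'] := short _ (LP i); exists w'.
have [i [j [lt_ij fij]]] : exists i j : 'I_M.+1, (i < j)%N /\ f i = f j.
  apply: contrapT => inj.
  suff : (size [seq f i | i <- enum 'I_M.+1] <= M)%N.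
    by rewrite size_map size_enum_ord ltnn.
  apply: uniq_leq_size.
    rewrite map_inj_uniq ?enum_uniq // => i j e; apply/val_inj.
    by have [lt|lt|//] := ltngtP i j; case: inj; [exists i, j|exists j, i].
  by move=> w /mapP[i _ ->]; rewrite mem_words_upto; have [] := hf i.
pose z : word d := FMonom (drop i (take j W)).
have Pj : P j = P i ** z.
  have e : take i (take j W) = take i W by rewrite take_takel // ltnW.
  by apply/wordP; rewrite wordM /= -e cat_take_drop.
have cij : congruent (P i) (P i ** z).
  rewrite -Pj; apply: congruent_trans (hf i).2 _; rewrite fij.
  exact/congruent_sym/(hf j).2.
have z1 : z <> mone.
  have le_jM : (j <= M)%N by rewrite -ltnS.
  move/wordP/(congr1 size); rewrite fm1 /= size_drop size_take_min sW.
  by rewrite (minn_idPl le_jM) => /eqP; rewrite subn_eq0 leqNgt lt_ij.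
have [n []] := no_wpow z1.
suff : congruent (P i) (P i ** wpow z n).
  move/congruent_lang/(_ (LP i)); apply: lang_sub; exact: subwordr.
elim: n => [|n IHn]; first by rewrite mulm1.
rewrite [wpow _ _]/= mulmA; apply: congruent_trans IHn _.
by have := congruentM mone (wpow z n) cij; rewrite !mul1m.
Qed.

End Congruence.

(** * Ideals of monomial algebras *)

Section LetterSum.
Variables (k : fieldType) (d : nat) (L : language d) (R : algType k).
Variable B : word_basis L R.
Local Notation wd := (wd B).
Local Notation cf := (cf B).
Implicit Types (u v w : word d) (b x y r : R).

Definition letter_sum : R := \sum_(i < d) wd (fmu i).

Let sum_delta (i : 'I_d) (c : bool) :
  \sum_(j < d) (c && (j == i))%:R = c%:R :> k.
Proof.
rewrite (bigD1 i) //= eqxx andbT big1 ?addr0 // => j /negPf ->.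
by rewrite andbF.
Qed.

Lemma cf_mul_letter_sum u i b :
  L (u ** fmu i) -> cf (u ** fmu i) (b * letter_sum) = cf u b.
Proof.
move=> Lui; have Lu : L u by apply: lang_sub Lui; apply: subwordl.
move: b; apply: (wd_ind (B := B)) => [|v Lv].
  split=> /= [|c x y ex ey]; first by rewrite mul0r !cf0.
  by rewrite mulrDl -scalerAl !cf_linear // ex ey.
rewrite mulr_sumr cf_sum // cf_wd // -[RHS](sum_delta i); apply: eq_bigr => j _.
rewrite -wdM cf_wd //; congr ((nat_of_bool _)%:R).
apply/eqP/andP => [e|[/eqP-> /eqP->]] //.
move/wordP: e; rewrite !wordM !fmU !cats1 => /rcons_inj[/wordP -> ->].
by rewrite !eqxx.
Qed.

Lemma cf_letter_sum_mul u i b :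
  L (fmu i ** u) -> cf (fmu i ** u) (letter_sum * b) = cf u b.
Proof.
move=> Lui; have Lu : L u by apply: lang_sub Lui; apply: subwordr.
move: b; apply: (wd_ind (B := B)) => [|v Lv].
  split=> /= [|c x y ex ey]; first by rewrite mulr0 !cf0.
  by rewrite mulrDr -scalerAr !cf_linear // ex ey.
rewrite mulr_suml cf_sum // cf_wd // -[RHS](sum_delta i); apply: eq_bigr => j _.
rewrite -wdM cf_wd //; congr ((nat_of_bool _)%:R).
apply/eqP/andP => [e|[/eqP-> /eqP->]] //.
by move/wordP: e; rewrite !wordM !fmU => -[-> /wordP ->]; rewrite !eqxx.
Qed.

Lemma cf1_mul_letter_sum b : cf mone (b * letter_sum) = 0.
Proof.
have L1 := lang1 L; move: b; apply: (wd_ind (B := B)) => [|v Lv].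
  split=> /= [|c x y ex ey]; first by rewrite mul0r !cf0.
  by rewrite mulrDl -scalerAl !cf_linear // ex ey mulr0 addr0.
rewrite mulr_sumr cf_sum // big1 // => j _; rewrite -wdM cf_wd //.
case: eqP => // /wordP/(congr1 size).
by rewrite size_wordM fmU fm1 addn1.
Qed.

Lemma cf1_letter_sum_mul b : cf mone (letter_sum * b) = 0.
Proof.
have L1 := lang1 L; move: b; apply: (wd_ind (B := B)) => [|v Lv].
  split=> /= [|c x y ex ey]; first by rewrite mulr0 !cf0.
  by rewrite mulrDr -scalerAr !cf_linear // ex ey mulr0 addr0.
rewrite mulr_suml cf_sum // big1 // => j _; rewrite -wdM cf_wd //.
case: eqP => // /wordP/(congr1 size).
by rewrite size_wordM fmU fm1.
Qed.

Lemma cf_one : cf mone 1 = 1.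
Proof. by rewrite -(wd1 B) cf_wd ?eqxx //; exact: lang1. Qed.

Lemma cf_one0 u : L u -> u <> mone -> cf u 1 = 0.
Proof. by move=> Lu u1; rewrite -(wd1 B) cf_wd //; case: eqP => // /esym. Qed.

Hypothesis longL : forall n, exists2 u, L u & size u = n.

Lemma cf_support b : exists2 u, L u & cf u b = 0.
Proof.
have [s [us sL ->]] := wd_expand B b.
have [u Lu su] := longL (\max_(v <- s) size v).+1.
exists u => //; rewrite cf_sum // big_seq big1 // => v vs.
rewrite cfZ // cf_wd //; case: eqP => [e|_]; last by rewrite mulr0.
have := @leq_bigmax_seq _ s xpredT (fun w : word d => size w) _ vs isT.
by rewrite e su ltnn.
Qed.

Lemma cfB u x y : L u -> cf u (x - y) = cf u x - cf u y.
Proof. by move=> Lu; rewrite cfD // -scaleN1r cfZ // mulN1r. Qed.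

Lemma letter_sum_nlinv b : b * (1 - letter_sum) <> 1.
Proof.
rewrite mulrBr mulr1 => e.
have [u Lu] := cf_support b; suff -> : cf u b = 1 by move/eqP; rewrite oner_eq0.
move: u Lu; apply: word_indr => [L1|i u IHu Lui].
  by rewrite -[LHS]subr0 -(cf1_mul_letter_sum b) -cfB // e cf_one.
have Lu : L u by apply: lang_sub Lui; apply: subwordl.
have : cf (u ** fmu i) (b - b * letter_sum) = 0.
  rewrite e cf_one0 // => /wordP/(congr1 size).
  by rewrite size_wordM fmU fm1 addn1.
by rewrite cfB // cf_mul_letter_sum // IHu // => /eqP; rewrite subr_eq0 => /eqP.
Qed.

Lemma letter_sum_nrinv b : (1 - letter_sum) * b <> 1.
Proof.
rewrite mulrBl mul1r => e.
have [u Lu] := cf_support b; suff -> : cf u b = 1 by move/eqP; rewrite oner_eq0.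
move: u Lu; apply: word_indl => [L1|i u IHu Lui].
  by rewrite -[LHS]subr0 -(cf1_letter_sum_mul b) -cfB // e cf_one.
have Lu : L u by apply: lang_sub Lui; apply: subwordr.
have : cf (fmu i ** u) (b - letter_sum * b) = 0.
  rewrite e cf_one0 // => /wordP/(congr1 size).
  by rewrite size_wordM fmU fm1.
by rewrite cfB // cf_letter_sum_mul // IHu // => /eqP; rewrite subr_eq0 => /eqP.
Qed.

Lemma letter_sumX n (S : set R) : submodule S ->
  (forall u, size u = n -> S (wd u)) -> S (letter_sum ^+ n).
Proof.
elim: n S => [|n IHn] S sS h.
  by rewrite expr0 -(wd1 B); apply: h; rewrite fm1.
rewrite exprS mulr_suml; apply: submodule_sum => // i _.
apply: (IHn [set x | S (wd (fmu i) * x)]) => [|u su] /=; last first.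
  by rewrite -wdM; apply: h; rewrite size_wordM fmU su.
split=> /= [|c x y Sx Sy]; first by rewrite mulr0; case: sS.
by rewrite mulrDr -scalerAr; apply: sS.2.
Qed.

End LetterSum.

Section Ideals.
Variables (k : fieldType) (d : nat) (L : language d) (R : algType k).
Variable B : word_basis L R.
Local Notation wd := (wd B).
Local Notation cf := (cf B).
Implicit Types (u v w p q : word d) (b x y r : R) (J : set R).
Hypotheses (recL : uniformly_recurrent L) (ucL : unbounded_complexity L).

Lemma two_sided_submodule J : two_sided J -> submodule J.
Proof.
move=> [J0 JB JM]; split=> // a x y Jx Jy.
have Jax : J (a *: x) by rewrite -mulr_algl; apply: (JM _ _ Jx).1.
by rewrite -[y]opprK -[- y]add0r; apply/JB/JB.
Qed.

(* The words in a combination of minimal length lying in J have the same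
   contexts, so there is only one. *)
Lemma ideal_word J : two_sided J -> (exists2 x, J x & x != 0) ->
  exists2 u, L u & J (wd u).
Proof.
move=> tJ [x Jx x0]; have [_ _ JM] := tJ.
pose P n := `[< exists (s : seq (word d)) (c : word d -> k),
  [/\ uniq s, size s = n, forall u, u \in s -> L u /\ c u != 0, (0 < n)%N &
      J (\sum_(u <- s) c u *: wd u)] >].
have exP : exists n, P n.
  have [s [us sL ex]] := wd_expand B x.
  pose s' := [seq u <- s | cf u x != 0].
  have ex' : x = \sum_(u <- s') cf u x *: wd u.
    rewrite big_filter {1}ex [RHS]big_mkcond; apply: eq_bigr => u _.
    by case: eqP => // ->; rewrite scale0r.
  exists (size s'); apply/asboolP; exists s', (cf^~ x); split => //.
  - exact: filter_uniq.
  - by move=> u; rewrite mem_filter => /andP[-> /sL].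
  - rewrite lt0n; apply: contra_neq x0 => /size0nil s0.
    by rewrite ex' s0 big_nil.
  - by rewrite -ex'.
case: (ex_minnP exP) => n /asboolP[s [c [us sz sLc n_gt0 Js]]] minn.
have ctx u v p q : u \in s -> v \in s -> L (p ** u ** q) -> L (p ** v ** q).
  move=> us' vs Lu.
  pose a w := `[< L (p ** w ** q) >].
  pose s' := [seq p ** w ** q | w <- s & a w].
  pose strip w : word d := FMonom (drop (size p) (take (size w - size q) w)).
  have stripE w : strip (p ** w ** q) = w.
    apply/wordP; rewrite /strip /= size_wordM addnK.
    by rewrite (wordM (p ** w)) take_size_cat // wordM drop_size_cat.
  suff /minn : P (size s').
    rewrite size_map size_filter -sz => le_sz.
    have : all a s by rewrite all_count eqn_leq count_size.
    by move=> /allP/(_ v vs)/asboolP.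
  apply/asboolP; exists s', (c \o strip); split => //.
  - rewrite map_inj_uniq ?filter_uniq // => w1 w2 e.
    by rewrite -[w1]stripE e stripE.
  - move=> _ /mapP[w + ->]; rewrite mem_filter /= stripE => /andP[/asboolP Lw ws].
    by split=> //; case: (sLc w ws).
  - rewrite size_map size_filter -has_count; apply/hasP; exists u => //.
    exact/asboolP.
  - rewrite big_map big_filter /=.
    rewrite (_ : \sum_(_ <- _ | _) _ = wd p * (\sum_(w <- s) c w *: wd w) * wd q).
      by apply: (JM _ _ _).2; apply: (JM _ _ _).1.
    rewrite mulr_sumr mulr_suml big_mkcond; apply: eq_bigr => w _.
    rewrite stripE -scalerAr -scalerAl -!wdM; case: ifPn => // /asboolP/wd_eq0 ->.
    by rewrite scaler0.
case: s us sz sLc Js ctx => [|u s] us sz sLc Js ctx.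
  by rewrite -sz in n_gt0.
have us' : u \in u :: s by rewrite mem_head.
case: s us sz sLc Js ctx us' => [|v s] us sz sLc Js ctx us'.
  exists u; first exact: (sLc u us').1.
  rewrite big_seq1 in Js.
  rewrite -[wd u](scalerK (sLc u us').2).
  exact: submoduleZ (two_sided_submodule tJ) Js.
have vs : v \in [:: u, v & s] by rewrite !inE eqxx orbT.
have e : u = v.
  apply: (congruent_eq recL ucL); first exact: (sLc u us').1.
    exact: (sLc v vs).1.
  by move=> p q; split; apply: ctx.
by move: us; rewrite e /= mem_head.
Qed.

Lemma ideal_long_words J : two_sided J -> (exists2 x, J x & x != 0) ->
  exists N, forall u, (N <= size u)%N -> J (wd u).
Proof.
move=> tJ Jx; have [J0 _ JM] := tJ; have [u Lu Ju] := ideal_word tJ Jx.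
have [N hN] := recL Lu; exists N => w le_Nw.
have [/hN/(_ le_Nw)[p [q ->]]|/(wd_eq0 B) -> //] := pselect (L w).
by rewrite !wdM; apply: (JM _ _ _).1; apply: (JM _ _ _).2.
Qed.

Lemma word_basis_just_infinite : just_infinite R.
Proof.
split.
  move=> [n [s [sz is_ sT]]]; have [l [t [ut lt_t ht]]] := ucL n.
  suff : (size [seq wd u | u <- t] <= size s)%N.
    by rewrite size_map sz leqNgt lt_t.
  apply: lin_indep_size; first by apply: wd_lin_indep => // u /ht[].
  by move=> x _; rewrite sT.
move=> J Jx.
have [|N hN] := @ideal_long_words [set x | x \in J] _ Jx.
  split=> [|x y|a x]; first exact: rpred0.
    exact: rpredB.
  by move=> /= xJ; split; [exact: idealMr|exact: ideal_mulr_subproof].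
apply: (@lspan_fin_dim _ _ [seq alg_pi J (wd u) | u <- words_upto d N]).
apply/seteqP; split=> // r _; have [x <-] := alg_pi_surj r.
have sl := lspan_submodule [seq alg_pi J (wd u) | u <- words_upto d N].
move: x; apply: (wd_ind (B := B)) => [|u Lu].
  split=> /= [|a x y hx hy]; first by rewrite rmorph0; case: sl.
  by rewrite rmorphD /= linearZ; apply: sl.2.
have [le_uN|lt_Nu] := leqP (size u) N.
  by apply/mem_lspan/map_f; rewrite mem_words_upto.
have -> : alg_pi J (wd u) = alg_pi J 0.
  by apply/eqP; rewrite alg_piP subr0; apply: hN; exact: ltnW.
by rewrite rmorph0; case: sl.
Qed.

Lemma word_basis_primitive : primitive R.
Proof.
have longL := lang_long ucL.
have JX J : two_sided J -> (exists2 x, J x & x != 0) ->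
    exists n, J (letter_sum B ^+ n).
  move=> tJ Jx; have [N hN] := ideal_long_words tJ Jx.
  exists N; apply: letter_sumX; first exact: two_sided_submodule.
  by move=> u su; apply: hN; rewrite su.
split.
  exact: (@left_primitive_criterion R (letter_sum B) (letter_sum_nlinv longL) JX).
apply: (@left_primitive_criterion R^c (letter_sum B : R^c)).
  exact: (letter_sum_nrinv longL).
move=> J [J0 JB JM] Jx; have [|n Jn] := JX J _ Jx; last by exists n; rewrite revrX.
by split=> // a x /(JM a)[].
Qed.

End Ideals.

(** * Bartholdi-Smoktunowicz words *)

Section WordProducts.
Variable d : nat.
Local Notation len := (@size 'I_d).
Implicit Types (a b u v w x y : word d) (X Y : {fset word d}).

Lemma size_eq u v : u = v -> len u = len v.
Proof. by move=> ->. Qed.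

Definition fset_mul X Y : {fset word d} := [fset mmul u v | u in X, v in Y]%fset.

Lemma fset_mulP X Y w :
  reflect (exists u v, [/\ u \in X, v \in Y & w = u ** v]) (w \in fset_mul X Y).
Proof.
apply: (iffP (imfset2P _ _ _ _ _)) => [[u uX [v vY e]]|[u [v [uX vY e]]]].
  by exists u, v.
by exists u => //; exists v.
Qed.

Lemma mulm_inj2 u v u' v' :
  len u = len u' -> u ** v = u' ** v' -> u = u' /\ v = v'.
Proof.
move=> su /wordP; rewrite !wordM => /eqP; rewrite eqseq_cat //.
by move=> /andP[/eqP/wordP -> /eqP/wordP ->].
Qed.

Lemma card_fset_mul X Y n : (forall u, u \in X -> len u = n) ->
  #|` fset_mul X Y| = (#|` X| * #|` Y|)%N.
Proof.
move=> sX; rewrite -(size_allpairs (fun u v : word d => u ** v)).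
apply/perm_size/uniq_perm; first exact: fset_uniq.
  apply: allpairs_uniq; rewrite ?fset_uniq // => -[u v] [u' v'].
  move=> /allpairsP[[a b] [/= aX _ [-> ->]]].
  move=> /allpairsP[[a' b'] [/= aX' _ [-> ->]]] e.
  by have [|-> ->] := mulm_inj2 _ e; rewrite ?sX.
move=> w; apply/fset_mulP/allpairsP => [[u [v [uX vY e]]]|[[u v] /= [uX vY e]]].
  by exists (u, v).
by exists u, v.
Qed.

Lemma word_split u n :
  (n <= len u)%N -> exists a b, [/\ u = a ** b & len a = n].
Proof.
move=> le_n; exists (FMonom (take n u)), (FMonom (drop n u)); split.
  by apply/wordP; rewrite wordM /= cat_take_drop.
by rewrite /= size_takel.
Qed.

Lemma subword_inside a b x y v w : a ** w ** b = x ** v ** y ->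
  (len a <= len x)%N -> (len b <= len y)%N -> subword v w.
Proof.
move=> e le_ax le_by.
have [x1 [x2 [ex sx1]]] := word_split le_ax; move: e.
rewrite ex -!mulmA => /mulm_inj2[//|_ e].
have [|y1 [y2 [ey sy1]]] := @word_split y (len y - len b).
  exact: leq_subr.
have sy2 : len y2 = len b.
  have := size_wordM y1 y2; rewrite -ey sy1; lia.
move: e; rewrite ey !mulmA => e.
have [] := mulm_inj2 _ e; last by move=> -> _; exists x2, y1; rewrite mulmA.
by have := size_eq e; rewrite /= !size_wordM sy2; lia.
Qed.

Lemma subword_cases u x y : subword u (x ** y) ->
  [\/ subword u x, subword u y |
    exists u1 u2 x' y', [/\ u = u1 ** u2, x = x' ** u1 & y = u2 ** y']].
Proof.
move=> [a [b e]].
have [le_ax|lt_xa] := leqP (len a) (len x); last first.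
  constructor 2; have [a1 [a2 [ea sa1]]] := word_split (ltnW lt_xa).
  move: e; rewrite ea -mulmA => /mulm_inj2[//|_ ->].
  by exists a2, b.
have [x1 [x2 [ex sx1]]] := word_split le_ax.
move: e; rewrite ex -mulmA => /mulm_inj2[//|ea e].
have [le_ux|lt_xu] := leqP (len u) (len x2).
  constructor 1; have [x3 [x4 [ex2 sx3]]] := word_split le_ux.
  move: e; rewrite ex2 -mulmA => /mulm_inj2[//|-> _].
  by exists x1, x4.
constructor 3; have [u1 [u2 [eu su1]]] := word_split (ltnW lt_xu).
move: e; rewrite eu -mulmA => /mulm_inj2[//|ex2 ey].
by exists u1, u2, x1, b; rewrite ex2 ey.
Qed.

End WordProducts.

Section BSWords.
Variables (d : nat) (C : nat -> {fset word d}).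
Local Notation W := (bs_words C).
Local Notation len := (@size 'I_d).
Implicit Types (a b u v w x y : word d).
Hypothesis d_gt0 : (0 < d)%N.
Hypothesis CW : forall i, (C i `<=` W i)%fset.
Hypothesis C_neq0 : forall i, (C i != fset0)%fset.

Lemma mem_C i u : u \in C i -> u \in W i.
Proof. exact/fsubsetP. Qed.

Lemma bs_wordsS i : W i.+1 = fset_mul (C i) (W i).
Proof. by []. Qed.

Lemma size_bs i u : u \in W i -> len u = (2 ^ i)%N.
Proof.
elim: i u => [|i IHi] u; first by move=> /imfsetP[j _ ->]; rewrite fmU.
rewrite bs_wordsS => /fset_mulP[x [y [/mem_C/IHi sx /IHi sy ->]]].
by rewrite size_wordM sx sy expnS mul2n addnn.
Qed.

Lemma card_bsS i : #|` W i.+1| = (#|` C i| * #|` W i|)%N.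
Proof. by apply: (@card_fset_mul _ _ _ (2 ^ i)) => u /mem_C/size_bs. Qed.

Lemma card_bs0 : #|` W 0| = d.
Proof.
rewrite card_imfset /=; last by move=> i j /wordP; rewrite !fmU => -[].
by rewrite -cardE card_ord.
Qed.

Lemma bs_nonempty i : exists u, u \in W i.
Proof.
elim: i => [|i [v vW]]; last first.
  have /fset0Pn[u uC] := C_neq0 i; exists (u ** v).
  by rewrite bs_wordsS; apply/fset_mulP; exists u, v.
by exists (fmu (Ordinal d_gt0)); apply/imfsetP; exists (Ordinal d_gt0).
Qed.

Lemma bs_extend i j u : (i <= j)%N -> u \in W i -> exists a, a ** u \in W j.
Proof.
move=> /subnK <-; elim: (j - i)%N => [|n IHn] uW.
  by exists mone; rewrite mul1m.
have [a aW] := IHn uW; have /fset0Pn[x xC] := C_neq0 (n + i).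
exists (x ** a); rewrite addSn bs_wordsS; apply/fset_mulP; exists x, (a ** u).
by rewrite mulmA.
Qed.

Lemma bs_suffix n m w : (n <= m)%N -> w \in W m ->
  exists a v, v \in W n /\ w = a ** v.
Proof.
move=> /subnK <-; elim: (m - n)%N w => [|i IHi] w wW.
  by exists mone, w; rewrite mul1m.
move: wW; rewrite addSn bs_wordsS => /fset_mulP[x [y [_ /IHi[a [v [vW ->]]] ->]]].
by exists (x ** a), v; rewrite mulmA.
Qed.

Lemma bs_prefix n m w : (n < m)%N -> w \in W m ->
  exists x b, x \in C n /\ w = x ** b.
Proof.
move=> /subnK <-; elim: (m - n.+1)%N w => [|i IHi] w.
  by rewrite bs_wordsS => /fset_mulP[x [y [xC _ ->]]]; exists x, y.
rewrite addSn bs_wordsS => /fset_mulP[x [y [/mem_C/IHi[x' [b [x'C ->]]] _ ->]]].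
by exists x', (b ** y); rewrite mulmA.
Qed.

Lemma bs_language1 : (fun u => exists i w, w \in W i /\ subword u w) mone.
Proof.
have [w wW] := bs_nonempty 0; exists 0%N, w; split=> //.
by exists mone, w; rewrite !mul1m.
Qed.

Definition bs_language : language d.
Proof.
apply: (Language bs_language1) => u w uw [i [v [vW wv]]].
by exists i, v; split=> //; apply: subword_trans wv.
Defined.
Local Notation L := bs_language.

Lemma bs_in_language i u : u \in W i -> L u.
Proof. by move=> uW; exists i, u; split=> //; apply: subword_refl. Qed.

(* Two consecutive blocks of level n in a word of higher level lie in C n, W n
   or in W n, C n. *)
Lemma subword_blocks n m u w : (n < m)%N -> w \in W m -> subword u w ->
  (len u <= 2 ^ n)%N ->
  exists2 z, z \in (W n.+1 `|` fset_mul (W n) (C n))%fset & subword u z.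
Proof.
move=> /subnK <-; elim: (m - n.+1)%N w => [|i IHi] w.
  by move=> wW uw _; exists w => //; rewrite in_fsetU wW.
rewrite addSn bs_wordsS => /fset_mulP[x [y [/mem_C xW yW ->]]].
case/subword_cases => [ux|uy|[u1 [u2 [x' [y' [-> ex ey]]]]]] su.
- exact: IHi ux su.
- exact: IHi uy su.
have [|a [v [vW ea]]] := @bs_suffix n _ _ _ xW.
  by rewrite addnS ltnW // ltnS leq_addl.
have [|c [b [cC eb]]] := @bs_prefix n _ _ _ yW.
  by rewrite addnS ltnS leq_addl.
exists (v ** c).
  by rewrite in_fsetU; apply/orP; right; apply/fset_mulP; exists v, c.
rewrite size_wordM in su.
have sv := size_bs vW; have sc := size_bs (mem_C cC).
apply: (@subword_inside _ a b x' y').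
  by rewrite -!mulmA -eb mulmA -ea ex ey !mulmA.
- have := size_eq ex.
  rewrite ea /= !size_wordM; lia.
- have := size_eq ey.
  rewrite eb /= !size_wordM; lia.
Qed.

Lemma lang_deep u n :
  L u -> exists m w, [/\ (n < m)%N, w \in W m & subword u w].
Proof.
move=> [i [w [wW uw]]]; exists (n.+1 + i)%N.
have [a aW] := bs_extend (leq_addl n.+1 i) wW.
exists (a ** w); split; rewrite ?leq_addr // ?addSn ?ltnS ?leq_addr //.
exact: subword_trans uw (subwordr _ _).
Qed.

Lemma bs_recurrent u :
  (exists t, forall x, x \in C t -> subword u x) ->
  exists N, forall w, L w -> (N <= len w)%N -> subword u w.
Proof.
move=> [t Ct]; exists (2 ^ t.+2)%N => w Lw le_w.
have [w1 [w2 [ew sw1]]] := word_split le_w.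
suff : subword u w1 by move/subword_trans; apply; rewrite ew; apply: subwordl.
have Lw1 : L w1 by apply: lang_sub Lw; rewrite ew; apply: subwordl.
have [m [z [lt_m zW w1z]]] := lang_deep t.+2 Lw1.
have [|p] := subword_blocks lt_m zW w1z; first by rewrite sw1.
move=> pWC [a [b e]].
have {pWC} [p1 [p2 [p1W p2W ep]]] : exists p1 p2,
    [/\ p1 \in W t.+2, p2 \in W t.+2 & p = p1 ** p2].
  move: pWC; rewrite in_fsetU bs_wordsS => /orP[]/fset_mulP[p1 [p2 [h1 h2 ->]]].
    by exists p1, p2; rewrite mem_C.
  by exists p1, p2; rewrite (mem_C h2).
have inner q : q \in W t.+1 -> subword u q.
  rewrite bs_wordsS => /fset_mulP[x [y [/Ct ux _ ->]]].
  exact: subword_trans ux (subwordl _ _).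
move: (p1W); rewrite bs_wordsS => /fset_mulP[x1 [y1 [/mem_C x1W y1W e1]]].
move: (p2W); rewrite bs_wordsS => /fset_mulP[x2 [y2 [/mem_C x2W y2W e2]]].
have := size_eq e; rewrite ep /= !size_wordM.
rewrite (size_bs p1W) (size_bs p2W) sw1 => es.
have sx1 := size_bs x1W; have sx2 := size_bs x2W.
have sy1 := size_bs y1W; have sy2 := size_bs y2W.
have E : (2 ^ t.+2 = 2 ^ t.+1 + 2 ^ t.+1)%N by rewrite [LHS]expnS mul2n addnn.
have [le_a|lt_a] := leqP (len a) (2 ^ t.+1).
  apply: subword_trans (inner _ y1W) _.
  apply: (@subword_inside _ a b x1 p2); first by rewrite -e1 -ep e mulmA.
    by rewrite sx1.
  by rewrite (size_bs p2W); lia.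
apply: subword_trans (inner _ x2W) _.
apply: (@subword_inside _ a b p1 y2).
  by rewrite -(mulmA p1) -e2 -ep e mulmA.
  by rewrite (size_bs p1W); lia.
by rewrite sy2; lia.
Qed.

Lemma size_lwords_le n :
  (size (lwords L (2 ^ n)) <= 2 ^ (2 * n + 4) * #|` W n.+1|)%N.
Proof.
pose Z := (W n.+1 `|` fset_mul (W n) (C n))%fset.
have cZ : (#|` Z| <= 2 * #|` W n.+1|)%N.
  rewrite mul2n -addnn; apply: leq_trans (leq_card_fsetU _ _) _.
  rewrite leq_add2l (@card_fset_mul _ _ _ (2 ^ n)); last by move=> u /size_bs.
  by rewrite card_bsS mulnC.
pose factor (z : word d) (ol : nat * nat) : word d :=
  FMonom (take ol.2 (drop ol.1 z)).
pose s := [seq factor z ol | z <- enum_fset Z,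
  ol <- [seq (o, l) | o <- iota 0 (2 ^ n.+1).+1, l <- iota 0 (2 ^ n).+1]].
have : (size (lwords L (2 ^ n)) <= size s)%N.
  apply: uniq_leq_size; first exact: uniq_lwords.
  move=> u /mem_lwords[Lu su].
  have [m [w [lt_m wW uw]]] := lang_deep n Lu.
  have [z zZ [a [b e]]] := subword_blocks lt_m wW uw su.
  have sz : len z = (2 ^ n.+1)%N.
    move: zZ; rewrite in_fsetU => /orP[/size_bs //|/fset_mulP[x [y [xW yC ->]]]].
    rewrite size_wordM (size_bs xW) (size_bs (mem_C yC)).
    by rewrite expnS mul2n addnn.
  have -> : u = factor z (len a, len u).
    by apply/wordP; rewrite /= e !wordM drop_size_cat // take_size_cat.
  apply: allpairs_f => //; apply: (allpairs_f (fun o l : nat => (o, l))).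
    by rewrite mem_iota /= add0n ltnS -sz e size_wordM leq_addr.
  by rewrite mem_iota /= add0n ltnS.
move/leq_trans; apply; rewrite !size_allpairs !size_iota.
have -> : (2 ^ (2 * n + 4) = 2 ^ n.+2 * 2 ^ n.+1 * 2)%N.
  by rewrite -expnD -expnSr; congr (2 ^ _)%N; lia.
have h1 : ((2 ^ n.+1).+1 <= 2 ^ n.+2)%N.
  by rewrite [X in (_ <= X)%N]expnS mul2n -addnn -addn1 leq_add2l expn_gt0.
have h2 : ((2 ^ n).+1 <= 2 ^ n.+1)%N.
  by rewrite expnS mul2n -addnn -addn1 leq_add2l expn_gt0.
apply: leq_trans (leq_mul cZ (leq_mul h1 h2)) _.
by rewrite (mulnC (2 * _)%N) -!mulnA.
Qed.

Lemma size_lwords_ge n : (#|` W n| <= size (lwords L (2 ^ n)))%N.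
Proof.
apply: uniq_leq_size; first exact: fset_uniq.
move=> u uW; apply/mem_lwords; split; first exact: bs_in_language uW.
by rewrite (size_bs uW).
Qed.

Lemma size_lwords_mono : {homo (fun n => size (lwords L n)) : m n / (m <= n)%N}.
Proof.
move=> m n le_mn; apply: uniq_leq_size; first exact: uniq_lwords.
move=> u /mem_lwords[Lu su]; apply/mem_lwords; split=> //.
exact: leq_trans le_mn.
Qed.

End BSWords.

Lemma ex_infinite_enum (T : countType) (t0 : T) :
  exists e : nat -> T, forall t N, exists2 i, (N <= i)%N & e i = t.
Proof.
exists (fun i => odflt t0 (choice.unpickle (logn 2 i))) => t N.
exists (2 ^ choice.pickle t * N.*2.+1)%N.
  apply: leq_trans (leq_pmull _ _); last by rewrite expn_gt0.
  by rewrite -addnn -addnS leq_addr.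
rewrite lognM ?expn_gt0 // pfactorK // logn_coprime; last first.
  by rewrite coprime2n /= odd_double.
by rewrite addn0 choice.pickleK.
Qed.

Lemma ex_subfset (T : choiceType) (X : {fset T}) n :
  exists Y : {fset T}, (Y `<=` X)%fset /\ ((n <= #|` X|)%N -> #|` Y| = n).
Proof.
exists [fset x in take n (enum_fset X)]%fset; split.
  by apply/fsubsetP => x; rewrite inE => /mem_take.
move=> le_n; rewrite card_fseq undup_id ?take_uniq ?fset_uniq //.
by rewrite size_takel.
Qed.

Section RecurrentChoice.
Variables (d : nat) (c w : nat -> nat).
Hypothesis c_gt0 : forall i, (0 < c i)%N.
Hypotheses (w0 : w 0 = d) (wS : forall i, w i.+1 = (c i * w i)%N).
Hypothesis le_cw : forall i, (c i <= w i)%N.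
Hypothesis small_c :
  forall M, exists n0, forall i, (n0 <= i)%N -> (c i * M <= w i)%N.

(* Every word is requested at infinitely many steps; a request is granted as
   soon as enough words contain the requested one, and then C t consists of
   such words. *)
Lemma ex_recurrent_choice : exists C : nat -> {fset word d},
  [/\ forall i, (C i `<=` bs_words C i)%fset, forall i, #|` C i| = c i,
      forall i, #|` bs_words C i| = w i &
      forall u, (exists i x, x \in bs_words C i /\ subword u x) ->
        exists t, forall x, x \in C t -> subword u x].
Proof.
have [e he] := ex_infinite_enum ([::] : seq 'I_d).
pose hits u (X : {fset word d}) := [fset x in X | `[< subword u x >]]%fset.
have hits_sub u X : (hits u X `<=` X)%fset by exact: fset_sub.
have /choice[pick pickP] : forall iX : nat * {fset word d},
    exists Y : {fset word d},
    [/\ (Y `<=` iX.2)%fset, (c iX.1 <= #|` iX.2|)%N -> #|` Y| = c iX.1 &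
    (c iX.1 <= #|` hits (FMonom (e iX.1)) iX.2|)%N ->
      forall x, x \in Y -> subword (FMonom (e iX.1)) x].
  move=> [i X] /=; set u := FMonom _.
  have [le_c|lt_c] := leqP (c i) #|` hits u X|.
    have [Y [YX cY]] := ex_subfset (hits u X) (c i); exists Y; split.
    - exact: fsubset_trans YX (hits_sub _ _).
    - by move=> _; apply: cY.
    - by move=> _ x /(fsubsetP YX); rewrite !inE => /andP[_ /asboolP].
  have [Y [YX cY]] := ex_subfset X (c i); exists Y; split=> //.
pose V := fix V i : {fset word d} :=
  if i is j.+1 then fset_mul (pick (j, V j)) (V j) else [fset fmu x | x in 'I_d]%fset.
pose C i := pick (i, V i).
have VE i : bs_words C i = V i by elim: i => //= i ->.
have CW i : (C i `<=` bs_words C i)%fset by rewrite VE; have [] := pickP (i, V i).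
have cardC i : #|` bs_words C i| = w i -> #|` C i| = c i.
  by rewrite VE => eW; have [_ h _] := pickP (i, V i); apply: h; rewrite eW.
have cardW i : #|` bs_words C i| = w i.
  elim: i => [|i IHi]; first by rewrite card_bs0 w0.
  by rewrite card_bsS // IHi cardC.
exists C; split=> // [i|u [i0 [x [xW ux]]]]; first exact: cardC.
have count_hits t : (w (t + i0) <= w i0 * #|` hits u (bs_words C (t + i0))|)%N.
  elim: t => [|t IHt].
    rewrite leq_pmulr // cardfs_gt0; apply/fset0Pn; exists x.
    by rewrite !inE xW; apply/asboolP.
  rewrite addSn wS; set j := (t + i0)%N in IHt *.
  have sub : (fset_mul (C j) (hits u (bs_words C j)) `<=` hits u (bs_words C j.+1))%fset.
    apply/fsubsetP => _ /fset_mulP[a [b [aC + ->]]].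
    rewrite !inE => /andP[bW /asboolP ub]; apply/andP; split.
      by apply/fset_mulP; exists a, b.
    by apply/asboolP; apply: subword_trans ub (subwordr _ _).
  apply: leq_trans (leq_mul (leqnn _) (fsubset_leq_card sub)).
  rewrite (@card_fset_mul _ _ _ (2 ^ j)); last by move=> a /(mem_C CW)/(size_bs CW).
  by rewrite cardC // mulnCA leq_mul2l IHt orbT.
have [n0 hn0] := small_c (w i0).
have [t le_t et] := he (u : seq 'I_d) (maxn n0 i0).
move: le_t; rewrite geq_max => /andP[le_n0t le_i0t].
exists t => y; have [_ _ /= h] := pickP (t, V t).
rewrite et fmK in h; apply: h; rewrite -VE.
have w_gt0 : (0 < w i0)%N by apply: leq_trans (le_cw i0).
rewrite -(leq_pmul2l w_gt0) mulnC; apply: leq_trans (hn0 _ le_n0t) _.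
by rewrite -(subnK le_i0t).
Qed.

End RecurrentChoice.

(** * Growth *)

Section CeilDiv.

Definition cdivn m n := ((m + n.-1) %/ n)%N.

Lemma cdivn_lb m n : (0 < n)%N -> (m <= cdivn m n * n)%N.
Proof.
move=> n_gt0; have := divn_eq (m + n.-1) n; have := ltn_pmod (m + n.-1) n_gt0.
rewrite /cdivn; lia.
Qed.

Lemma cdivn_ub m n : (0 < n)%N -> (cdivn m n * n < m + n)%N.
Proof.
by move=> n_gt0; have := leq_trunc_div (m + n.-1) n; rewrite /cdivn; lia.
Qed.

Lemma cdivn_ceil m n : (0 < n)%N ->
  (cdivn m n)%:Z = Num.ceil (m%:R / n%:R : rat).
Proof.
move=> n_gt0; have n0 : (0 : rat) < n%:R by rewrite ltr0n.
apply/esym/ceil_def; rewrite ltr_pdivlMr // ler_pdivrMr // intrB.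
rewrite mulrBl mul1r ltrBlDr -!pmulrn -!natrM -natrD ltr_nat ler_nat.
by rewrite cdivn_ub // cdivn_lb.
Qed.

End CeilDiv.

Section Growth.
Variable f : nat -> nat.
Hypothesis f_pos : forall n, (0 < n)%N -> (0 < f n)%N.
Hypothesis f_incr : forall n, (0 < n)%N -> (f n < f n.+1)%N.
Hypothesis f_submul :
  forall n m, (0 < n)%N -> (0 < m)%N -> (f (n + m) <= f n * f m)%N.
Hypothesis f_beta : forall b, exists n0, forall n, (n0 <= n)%N ->
  (b * f (2 ^ n.+1) <= f (2 ^ n) ^ 2)%N.

Definition bs_card (i : nat) : nat := cdivn (f (2 ^ i.+1)) (f (2 ^ i)).
Definition bs_size (i : nat) : nat := (f 1 * \prod_(0 <= j < i) bs_card j)%N.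

Lemma f_mono m n : (0 < m)%N -> (m <= n)%N -> (f m <= f n)%N.
Proof.
move=> m_gt0 /subnK <-; elim: (n - m)%N => // i IHi.
by apply: leq_trans IHi (ltnW _); apply: f_incr; rewrite addn_gt0 m_gt0 orbT.
Qed.

Lemma f_ge_id n : (0 < n)%N -> (n <= f n)%N.
Proof.
elim: n => // -[|n] IHn _; first exact: f_pos.
by apply: leq_ltn_trans (IHn _) (f_incr _).
Qed.

Lemma f2_gt0 i : (0 < f (2 ^ i))%N.
Proof. by rewrite f_pos // expn_gt0. Qed.

Lemma bs_size0 : bs_size 0 = f 1.
Proof. by rewrite /bs_size big_geq // muln1. Qed.

Lemma bs_sizeS i : bs_size i.+1 = (bs_card i * bs_size i)%N.
Proof. by rewrite /bs_size big_nat_recr //= mulnA mulnC. Qed.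

Lemma bs_size_ge i : (f (2 ^ i) <= bs_size i)%N.
Proof.
elim: i => [|i IHi]; first by rewrite /bs_size big_geq // muln1 expn0.
rewrite bs_sizeS; apply: leq_trans (cdivn_lb _ (f2_gt0 i)) _.
by rewrite leq_mul2l IHi orbT.
Qed.

Lemma bs_card_gt0 i : (0 < bs_card i)%N.
Proof.
have := cdivn_lb (f (2 ^ i.+1)) (f2_gt0 i); rewrite -/(bs_card i).
by case: bs_card => //; rewrite mul0n leqNgt f2_gt0.
Qed.

Lemma bs_card_le i : (bs_card i <= bs_size i)%N.
Proof.
apply: leq_trans (bs_size_ge i); rewrite -ltnS.
have := cdivn_ub (f (2 ^ i.+1)) (f2_gt0 i); rewrite -/(bs_card i).
have := f_submul (n := 2 ^ i) (m := 2 ^ i); rewrite !expn_gt0 addnn -mul2n -expnS.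
have := f2_gt0 i; move=> h /(_ isT isT) h1 h2.
rewrite -(ltn_pmul2r h); apply: leq_trans h2 _; rewrite mulSn addnC leq_add2l //.
Qed.

Lemma bs_card_small M :
  exists n0, forall i, (n0 <= i)%N -> (bs_card i * M <= bs_size i)%N.
Proof.
have [n0 hn0] := f_beta (2 * M); exists (n0 + 2 * M)%N => i le_i.
apply: leq_trans (bs_size_ge i).
have := hn0 i (leq_trans (leq_addr _ _) le_i).
have := cdivn_ub (f (2 ^ i.+1)) (f2_gt0 i); rewrite -/(bs_card i).
have : (2 * M <= f (2 ^ i))%N.
  apply: leq_trans (f_ge_id _); last by rewrite expn_gt0.
  by apply: leq_trans (ltnW (ltn_expl i _)) => //; apply: leq_trans le_i; rewrite leq_addl.
have := f2_gt0 i.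
move: (f (2 ^ i)) (f (2 ^ i.+1)) (bs_card i) => F G c F0 h1 h2 h3.
rewrite leqNgt; apply/negP => lt_F.
have : (F * F < c * M * F)%N by rewrite ltn_pmul2r.
have : (2 * M * (c * F) <= 2 * M * (G + F))%N by rewrite leq_mul2l (ltnW h2) orbT.
have : (2 * M * F <= F * F)%N by rewrite leq_mul2r h1 orbT.
rewrite expnS expn1 in h3; nia.
Qed.

Variable alpha : nat.
Hypothesis alpha_gt0 : (0 < alpha)%N.
Hypothesis f_alpha : forall n, (0 < n)%N -> (n * f n <= f (alpha * n))%N.
Variable K : nat.
Hypothesis K_gt0 : (0 < K)%N.
Hypothesis le_bs_size : forall n, (bs_size n <= K * f (2 ^ n))%N.

Lemma growth_equiv_bs (g : nat -> nat) :
  {homo g : m n / (m <= n)%N} ->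
  (forall n, (bs_size n <= g (2 ^ n))%N) ->
  (forall n, (g (2 ^ n) <= 2 ^ (2 * n + 4) * bs_size n.+1)%N) ->
  growth_equiv g f.
Proof.
move=> g_mono g_lb g_ub.
have absorb M n : (0 < M)%N -> (0 < n)%N -> (M * f n <= f (alpha * (M * n)))%N.
  move=> M0 n0; have Mn0 : (0 < M * n)%N by rewrite muln_gt0 M0.
  apply: leq_trans (f_alpha Mn0); apply: leq_mul; first by rewrite leq_pmulr.
  by apply: f_mono => //; rewrite leq_pmull.
have log_bounds n : (0 < n)%N -> exists m, (2 ^ m <= n)%N /\ (n <= 2 ^ m.+1)%N.
  move=> n0; exists (trunc_log 2 n).
  by have := trunc_log_bounds (erefl : 1 < 2)%N n0 => /andP[-> /ltnW].
have f_le_g n : (0 < n)%N -> (f n <= g (2 * n))%N.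
  move=> n0; have [m [le_m le_n]] := log_bounds n n0.
  apply: leq_trans (f_mono n0 le_n) _; apply: leq_trans (bs_size_ge _) _.
  by apply: leq_trans (g_lb _) _; apply: g_mono; rewrite expnS leq_mul2l le_m orbT.
pose C := (alpha * (16 * K * (alpha * alpha * 4)))%N.
have C0 : (0 < C)%N by rewrite !muln_gt0 alpha_gt0 K_gt0.
exists C, (2 * C)%N; split=> // [|n n0]; first by rewrite muln_gt0.
apply/andP; split; last by rewrite -mulnA; apply: f_le_g; rewrite muln_gt0 C0.
have [m [le_m le_n]] := log_bounds n n0.
pose N := (2 ^ m.+2)%N; have N0 : (0 < N)%N by rewrite expn_gt0.
have le_N : (N <= 4 * n)%N by rewrite /N !expnS mulnA leq_mul2l le_m.
have gN : (g n <= 4 * K * (N * (N * f N)))%N.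
  apply: leq_trans (g_mono _ _ le_n) _; apply: leq_trans (g_ub _) _.
  have -> : (2 ^ (2 * m.+1 + 4) = 4 * (N * N))%N.
    by rewrite /N -(expnD 2) -(expnD 2 2); congr (2 ^ _)%N; lia.
  have := le_bs_size m.+2; rewrite -/N => h.
  apply: leq_trans (leq_mul (leqnn _) h) _.
  by rewrite (_ : 4 * (N * N) * (K * f N) = 4 * K * (N * (N * f N)))%N //; lia.
apply: leq_trans gN _.
have NN : (N * (N * f N) <= f (alpha * (alpha * N)))%N.
  apply: leq_trans (leq_mul (leqnn N) (f_alpha N0)) _.
  have aN0 : (0 < alpha * N)%N by rewrite muln_gt0 alpha_gt0.
  by apply: leq_trans (f_alpha aN0); rewrite leq_mul2r leq_pmull ?orbT.
apply: leq_trans (leq_mul (leqnn _) NN) _.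
have K4 : (0 < 4 * K)%N by rewrite muln_gt0 K_gt0.
have aaN : (0 < alpha * (alpha * N))%N by rewrite 2!muln_gt0 alpha_gt0 N0.
apply: leq_trans (absorb _ _ K4 aaN) _; apply: f_mono.
  by rewrite muln_gt0 alpha_gt0 muln_gt0 K4.
rewrite /C -!mulnA leq_mul2l; apply/orP; right.
nia.
Qed.

End Growth.

Section Main.
Variables (k : fieldType) (f : nat -> nat).
Hypothesis f_pos : forall n, (0 < n)%N -> (0 < f n)%N.
Hypothesis f_incr : forall n, (0 < n)%N -> (f n < f n.+1)%N.
Hypothesis f_submul :
  forall n m, (0 < n)%N -> (0 < m)%N -> (f (n + m) <= f n * f m)%N.
Hypothesis f_alpha : exists2 alpha : nat, (0 < alpha)%N &
  forall n, (0 < n)%N -> (n * f n <= f (alpha * n))%N.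
Hypothesis f_beta : forall b, exists n0, forall n, (n0 <= n)%N ->
  (b * f (2 ^ n.+1) <= f (2 ^ n) ^ 2)%N.
Hypothesis f_prod : exists2 K, (0 < K)%N &
  forall n, (bs_size f n <= K * f (2 ^ n))%N.

Lemma bartholdi_smoktunowicz_exists : exists R : algType k,
  [/\ fin_generated R, monomial_algebra R, just_infinite R & primitive R] /\
  [/\ has_growth_type R f & bartholdi_smoktunowicz f R].
Proof.
have f1_gt0 : (0 < f 1)%N by exact: f_pos.
have [C [CW cardC cardW recC]] := ex_recurrent_choice
  (bs_card_gt0 f_pos) (bs_size0 f) (bs_sizeS f)
  (bs_card_le f_pos f_submul) (bs_card_small f_pos f_incr f_beta).
have C_neq0 i : (C i != fset0)%fset by rewrite -cardfs_gt0 cardC bs_card_gt0.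
pose L := bs_language f1_gt0 C_neq0.
have recL : uniformly_recurrent L by move=> u /recC; apply: bs_recurrent.
have ucL : unbounded_complexity L.
  move=> m; exists (2 ^ m)%N, (enum_fset (bs_words C m)); split.
  - exact: fset_uniq.
  - rewrite cardW; apply: leq_trans (bs_size_ge f_pos m).
    apply: leq_trans (f_ge_id f_pos f_incr _); last by rewrite expn_gt0.
    exact: ltn_expl.
  - by move=> u uW; split; [apply: bs_in_language uW|apply: size_bs uW].
pose B := mono_alg_word_basis k L.
exists (mono_alg k L); split; split.
- exact: (word_basis_fin_generated B).
- exact: mono_alg_monomial.
- exact: (word_basis_just_infinite B).
- exact: (word_basis_primitive B).
- apply: (word_basis_growth B).
  have [alpha alpha_gt0 f_alpha'] := f_alpha; have [K K_gt0 le_K] := f_prod.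
  apply: (growth_equiv_bs f_pos f_incr alpha_gt0 f_alpha' K_gt0 le_K).
  + exact: size_lwords_mono.
  + by move=> n; rewrite -cardW; apply: size_lwords_ge.
  + by move=> n; rewrite -cardW; apply: size_lwords_le.
- exists C, (mono_ideal k L); split.
  + move=> i; split; first exact: CW.
    by rewrite cardC; apply: cdivn_ceil; apply: f2_gt0.
  + exact: mono_idealE.
  + exists (GRing.LRMorphism.clone k _ _ *:%R (@idfun (mono_alg k L)) _).
    by exists idfun.
Qed.

End Main.

End MonomialAlgebras.

From mathcomp Require Import reals topology normedtype sequences.
Import numFieldNormedType.Exports.

Theorem theorem2p1 (k : fieldType) (RR : realType) (f : nat -> nat)
  (f_pos : forall n, (0 < n)%N -> (0 < f n)%N)
  (f_incr : forall n, (0 < n)%N -> (f n < f n.+1)%N)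
  (f_submul : forall n m, (0 < n)%N -> (0 < m)%N -> (f (n + m) <= f n * f m)%N)
  (f_alpha : exists2 alpha : nat, (0 < alpha)%N &
     forall n, (0 < n)%N -> (n * f n <= f (alpha * n))%N)
  (f_beta : forall beta : RR, 0 < beta ->
     exists2 n_beta : nat, (0 < n_beta)%N &
       forall n, (n_beta <= n)%N ->
         (f (2 ^ (n + 1))%N)%:R <= beta^-1 * (f (2 ^ n)%N)%:R ^+ 2)
  (f_prod : cvgn (fun N : nat =>
     \prod_(0 <= n < N)
       (1 + (f (2 ^ n)%N)%:R / (f (2 ^ (n + 1))%N)%:R) : RR)) :
  exists R : algType k,
    [/\ fin_generated R, monomial_algebra R, just_infinite R & primitive R] /\
    [/\ has_growth_type R f & bartholdi_smoktunowicz f R].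
Proof.
have f2R_gt0 n : 0 < (f (2 ^ n)%N)%:R :> RR by rewrite ltr0n f_pos // expn_gt0.
apply: bartholdi_smoktunowicz_exists => // [b|].
  have [n0 _ hn0] := f_beta b.+1%:R (ltr0Sn _ _); exists n0 => n /hn0.
  rewrite addn1 ler_pdivlMl ?ltr0n // -natrX -natrM ler_nat.
  by apply: leq_trans; rewrite leq_mul2r leqnSn orbT.
have [M [_ hM]] := cvg_seq_bounded f_prod.
have [K hK] : exists K : nat, forall n,
    \prod_(0 <= i < n) (1 + (f (2 ^ i)%N)%:R / (f (2 ^ (i + 1))%N)%:R) <= K%:R :> RR.
  have lt_M : M < `|M| + 1 by rewrite (le_lt_trans (ler_norm _)) // ltrDl.
  exists (Num.bound (`|M| + 1)) => n.
  apply: le_trans (ler_norm _) (le_trans (hM _ lt_M n _) (ltW (archi_boundP _))) => //.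
  by rewrite addr_ge0.
exists K.+1 => // n; rewrite -(ler_nat RR) natrM.
have : (bs_size f n)%:R <= \prod_(0 <= i < n)
    (1 + (f (2 ^ i)%N)%:R / (f (2 ^ (i + 1))%N)%:R) * (f (2 ^ n)%N)%:R :> RR.
  elim: n => [|n IHn]; first by rewrite /bs_size !big_geq // muln1 mul1r.
  rewrite bs_sizeS natrM big_nat_recr //= addn1.
  apply: le_trans (ler_wpM2l (ler0n _ _) IHn) _.
  rewrite mulrCA -mulrA ler_wpM2l //.
    by apply: prodr_ge0 => i _; rewrite addr_ge0 // divr_ge0.
  rewrite mulrDl mul1r mulfVK ?gt_eqF //.
  by rewrite -natrM -natrD ler_nat ltnW // cdivn_ub // f_pos // expn_gt0.
move=> h; apply: le_trans h _; rewrite ler_wpM2r //.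
by apply: le_trans (hK n) _; rewrite ler_nat.
Qed.
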